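(* Let $\lambda_1,\lambda_2:\mathbb{R}\to\mathbb{R}$ be smooth with $\lambda_1(\tau)<\lambda_2(\tau)$, $|\lambda_1'(\tau)|<1$, $|\lambda_2'(\tau)|<1$ for all $\tau\in\mathbb{R}$; let $\ell_i:=\{(\tau,\lambda_i(\tau))\mid\tau\in\mathbb{R}\}$ and $$\mathcal{U}^\ell:=\{(\tau,y)\in\mathbb{R}^{1+1}\mid\lambda_1(\tau)<y<\lambda_2(\tau)\}.$$ Let $\mathcal{X}\in C^\infty(\overline{\mathcal{U}^\ell};\mathbb{R}^{1+1})$, $V\in C^\infty(\overline{\mathcal{U}^\ell})$, and fix $\tau_\pm\in\mathbb{R}$. Assume: (i) there exists $T_->0$ such that $\lambda_2(\tau_-)-T_-=\lambda_1(\tau_-+T_-)$; (ii) there exists $T_+>0$ such that $\lambda_1(\tau_-+T_-)+T_+=\lambda_2(\tau_-+T_-+T_+)$; (iii) $\tau_+>\tau_-+T_-+T_+$. Then there is a constant $C>0$ depending only on $\ell_1,\ell_2,\tau_\pm,V,\mathcal{X}$ such that, for any solution $\phi\in C^2(\mathcal{U}^\ell)\cap C^1(\overline{\mathcal{U}^\ell})$ of $(\Box\phi+\nabla_{\mathcal{X}}\phi+V\phi)|_{\mathcal{U}^\ell}=0$ that also satisfies $\phi|_{\ell_1\cup\ell_2}=0$, and for each choice of sign $\pm$, $$\int_{\mathcal{U}^\ell\cap\{t=\tau_\pm\}}(|\nabla_{t,x}\phi|^2+\phi^2)\le C\int_{\ell_2\cap\{\tau_-<t<\tau_+\}}|\partial_x\phi|^2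 .$$
   Context: $\mathbb{R}^{1+1}$ has coordinates $(t,x)$ and Minkowski metric $g=-dt^2+dx^2$; $\Box=-\partial_{tt}^2+\partial_{xx}^2$; $\nabla_{\mathcal{X}}\phi$ is the derivative of $\phi$ along $\mathcal{X}$; $|\nabla_{t,x}\phi|^2:=(\partial_t\phi)^2+(\partial_x\phi)^2$. Integrals over curves use the length measure induced by $g$ (for $\ell_i$: $\sqrt{1-|\lambda_i'|^2}\,d\tau$). Condition (i) says that the forward, leftward null ray from $(\tau_-,\lambda_2(\tau_-))\in\ell_2$ meets $\ell_1$ at time $\tau_-+T_-$; (ii) says that the forward, rightward null ray from that point of $\ell_1$ meets $\ell_2$ at time $\tau_-+T_-+T_+$. *)

(* Defs.v *)
From Stdlib Require Import Reals.
From Coquelicot Require Import Coquelicot.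
Open Scope R_scope.

(* Functions on R^{1+1} are curried total functions, time coordinate first.
   A function on a subset is represented by any total function: only its values
   on that subset are ever used. *)

Definition smooth (f : R -> R) : Prop := forall (n : nat) (x : R), ex_derive_n f n x.

Definition closure (U : R * R -> Prop) (p : R * R) : Prop :=
  forall eps : posreal, exists q, ball p eps q /\ U q.

Definition continuous_on_closure (U : R * R -> Prop) (f : R -> R -> R) : Prop :=
  continuous_on (closure U) (fun p => f (fst p) (snd p)).

(* [g] restricted to the closure of [U] is the continuous extension of [f|_U]. *)
Definition continuous_extension (U : R * R -> Prop) (f g : R -> R -> R) : Prop :=
  (forall t x, U (t, x) -> g t x = f t x) /\ continuous_on_closure U g.

(* C^k(U), meant for open [U]. *)
Definition Ck (k : nat) (U : R * R -> Prop) (f : R -> R -> R) : Prop :=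
  forall t x, U (t, x) -> ex_diff_n f k t x.

(* C^k of the closure of an open [U]: all partial derivatives of order <= k on [U]
   extend continuously to the closure, the extension of order 0 being [f] itself. *)
Definition Ck_closure (k : nat) (U : R * R -> Prop) (f : R -> R -> R) : Prop :=
  Ck k U f /\ continuous_on_closure U f /\
  forall i j : nat, (i + j <= k)%nat ->
    exists g, continuous_extension U (partial_derive i j f) g.

Definition Cinfty_closure (U : R * R -> Prop) (f : R -> R -> R) : Prop :=
  forall k, Ck_closure k U f.

Definition dt (f : R -> R -> R) : R -> R -> R := partial_derive 1 0 f.
Definition dx (f : R -> R -> R) : R -> R -> R := partial_derive 0 1 f.

Definition box (f : R -> R -> R) (t x : R) : R :=
  - partial_derive 2 0 f t x + partial_derive 0 2 f t x.

(* Derivative along the vector field X = (X^t, X^x). *)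
Definition nabla (X : R -> R -> R * R) (f : R -> R -> R) (t x : R) : R :=
  fst (X t x) * dt f t x + snd (X t x) * dx f t x.

Definition grad_sq (f : R -> R -> R) (t x : R) : R := (dt f t x)^2 + (dx f t x)^2.

Definition region (l1 l2 : R -> R) (p : R * R) : Prop :=
  l1 (fst p) < snd p < l2 (fst p).

(* Integral over the intersection of [region l1 l2] with {t = s}. A Riemann
   integral does not see the endpoints, so only values in the region matter. *)
Definition slice_integral (l1 l2 : R -> R) (s : R) (f : R -> R -> R) : R :=
  RInt (fun x => f s x) (l1 s) (l2 s).

(* Integral over {(t, l t) | a < t < b} for the Minkowski length of the
   timelike curve t |-> (t, l t). *)
Definition curve_integral (l : R -> R) (a b : R) (f : R -> R -> R) : R :=
  RInt (fun t => f t (l t) * sqrt (1 - (Rabs (Derive l t))^2)) a b.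

(* Main.v *)
Require Import Defs.
From Stdlib Require Import Reals Lra Psatz.
From Coquelicot Require Import Coquelicot.
Open Scope R_scope.

(** Put p = phi_t + phi_x and q = phi_t - phi_x. Up to terms of order zero in
    (p, q, phi), p is constant along the rays t + x = const and q along the rays
    t - x = const. On l2 both are multiples of the datum h = phi_x; on l1 the
    condition phi = 0 makes p and q comparable, so a ray that hits l1 is
    reflected into a ray of the other family. Write a = taum, m = taum + Tm,
    e = m + Tp for the times of the zigzag in hypotheses (i) and (ii), and b for
    taup.

    Every null ray of the slab a <= t <= b reaches l2 within that time interval,
    after at most one reflection, provided its sense is chosen well:
    - in the triangle cut off by the zigzag, follow p back and q forward in
      time, both to l2;
    - above the triangle, follow p back in time to l2 or to the triangle, and q
      back to l1, where it continues as p;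
    - the part below the triangle is the part above it, with time reversed.

    Along these routes the values are bounded pointwise: p at (t, x) by a
    constant times |h(sigma)| + B, where sigma is the time at which the route
    of the ray ends on l2 and B bounds the integral of |h|, and similarly q and
    phi. This is an absorption argument ([ray_propagation]): with a weight that
    grows exponentially along all routes, and with a large multiple of B in
    place of B, integrating the lower order terms costs at most half of the
    bound that is fed in. The triangle needs a weight in x (the equation is
    solved sideways, from l2 to the left), the region above it a weight in t;
    these are [inner_estimate] and [outer_estimate].

    Squaring the bounds on the slice t = b and changing variables from x to
    sigma, whose Jacobian is bounded because the curves are timelike, bounds the
    energy by the integral of h^2 plus B^2, and B^2 is controlled by the
    integral of h^2 through the Cauchy-Schwarz inequality
    ([final_slice_observability]). Time reversal gives the slice t = a
    ([initial_slice_observability]). The solution is only C^1 up to the boundary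
    and its second derivatives may blow up there, so the equation is used only
    along open segments of rays, through a mean value inequality. *)

(** * Functions of one variable *)
Lemma ex_RInt_continuous_everywhere (f : R -> R) (a b : R) :
  (forall x, continuous f x) -> ex_RInt f a b.
Proof.
intros H. apply (ex_RInt_continuous (V := R_CompleteNormedModule)). intros; apply H.
Qed.

Lemma continuous_sq {U : UniformSpace} (f : U -> R) (z : U) :
  continuous f z -> continuous (fun z => (f z) ^ 2) z.
Proof.
intros Cf. apply (continuous_comp f (fun y => y ^ 2)); [exact Cf|].
apply (ex_derive_continuous (V := R_NormedModule)). auto_derive; trivial.
Qed.

Lemma continuous_cmul {U : UniformSpace} (c : R) (f : U -> R) (z : U) :
  continuous f z -> continuous (fun z => c * f z) z.
Proof. intros Cf. exact (continuous_scal_r (V := R_NormedModule) c f z Cf). Qed.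

Lemma RInt_cmul (c : R) (f : R -> R) (a b : R) :
  (forall x, continuous f x) -> RInt (fun x => c * f x) a b = c * RInt f a b.
Proof.
intros Cf. apply (RInt_scal (V := R_CompleteNormedModule) f a b c). now apply ex_RInt_continuous_everywhere.
Qed.

(** Nothing is assumed on the derivative at the end points: the functions below
    are differentiable along a ray only until the ray reaches the boundary. *)
Lemma nonneg_derivative_le (H : R -> R) (a b : R) :
  a <= b -> (forall s, continuous H s) ->
  (forall s, a < s < b -> exists r, is_derive H s r /\ 0 <= r) ->
  H a <= H b.
Proof.
intros Hab CH HD.
set (dH := fun s => if Rlt_dec a s then if Rlt_dec s b then Derive H s else 0 else 0).
destruct (MVT_gen H a b dH) as [c [_ E]].
- rewrite Rmin_left, Rmax_right by lra. intros s Hs. unfold dH.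
  destruct (Rlt_dec a s); [|lra]. destruct (Rlt_dec s b); [|lra].
  destruct (HD s Hs) as (g & Hr & _). apply Derive_correct. exists g; exact Hr.
- intros s _. apply continuity_pt_filterlim, CH.
- assert (0 <= dH c); [|nra].
  unfold dH. destruct (Rlt_dec a c); [|lra]. destruct (Rlt_dec c b); [|lra].
  destruct (HD c) as (g & Hr & Hpos); [lra|]. now rewrite (is_derive_unique _ _ _ Hr).
Qed.

(** A mean value inequality with a majorant G instead of an integral, since the
    derivative of F need not be integrable up to the end points. *)
Lemma increment_le (F G : R -> R) (a b : R) :
  a <= b ->
  (forall s, continuous F s) -> (forall s, continuous G s) ->
  (forall s, a < s < b -> exists r g, is_derive F s r /\ is_derive G s g /\ Rabs r <= g) ->
  Rabs (F b - F a) <= G b - G a.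
Proof.
intros Hab CF CG HD.
apply Rabs_le. split.
- enough (G a + F a <= G b + F b) by lra.
  apply (nonneg_derivative_le (fun s => G s + F s)); trivial.
  + intros s. apply (continuous_plus (V := R_NormedModule)); auto.
  + intros s Hs. destruct (HD s Hs) as (r & g & Hr & Hg & Hle). exists (g + r). split.
    * apply (is_derive_plus (V := R_NormedModule)); trivial.
    * apply Rabs_le_between in Hle. lra.
- enough (G a - F a <= G b - F b) by lra.
  apply (nonneg_derivative_le (fun s => G s - F s)); trivial.
  + intros s. apply (continuous_minus (V := R_NormedModule)); auto.
  + intros s Hs. destruct (HD s Hs) as (r & g & Hr & Hg & Hle). exists (g - r). split.
    * apply (is_derive_minus (V := R_NormedModule)); trivial.
    * apply Rabs_le_between in Hle. lra.
Qed.

(** The inverse of f on [f a, f b], extended by constants to the line so that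
    integrands built from it are continuous everywhere. Its continuity comes
    from strict monotonicity alone. *)
Lemma clamped_inverse_exists (f : R -> R) (a b : R) :
  a <= b -> (forall s, continuous f s) -> (forall s t, s < t -> f s < f t) ->
  exists sigma : R -> R, (forall y, continuous sigma y) /\
    (forall y, a <= sigma y <= b) /\
    (forall y, f a <= y <= f b -> f (sigma y) = y).
Proof.
intros Hab Cf Inc.
assert (Mon : forall s t, s <= t -> f s <= f t).
{ intros s t [Hs| ->]; [apply Rlt_le, Inc, Hs|lra]. }
pose proof (Mon a b Hab) as Hf.
set (cl := fun y => Rmax (f a) (Rmin y (f b))).
assert (Hcl : forall y, f a <= cl y <= f b).
{ intros y. unfold cl, Rmax, Rmin. destruct (Rle_dec y (f b)); destruct (Rle_dec (f a) _); lra. }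
assert (Hlip : forall y z, Rabs (cl y - cl z) <= Rabs (y - z)).
{ intros y z. unfold cl, Rmax, Rmin.
  repeat (destruct (Rle_dec _ _)); unfold Rabs; repeat (destruct (Rcase_abs _)); lra. }
assert (Hsig : forall y, {x : R | a <= x <= b /\ f x = cl y}).
{ intros y. destruct (IVT_gen f a b (cl y)) as [x [Hx E]].
  - intros x. apply continuity_pt_filterlim, Cf.
  - rewrite Rmin_left, Rmax_right by lra. apply Hcl.
  - rewrite Rmin_left, Rmax_right in Hx by lra. exists x; tauto. }
exists (fun y => proj1_sig (Hsig y)). split; [|split].
- intros y. apply filterlim_locally. intros eps.
  destruct (Hsig y) as [u [Hu Eu]] eqn:E. simpl.
  assert (Hp : 0 < pos eps / 2) by (destruct eps; simpl; lra).
  assert (Hr : 0 < f (u + pos eps / 2) - f u) by (apply Rlt_0_minus, Inc; lra).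
  assert (Hl : 0 < f u - f (u - pos eps / 2)) by (apply Rlt_0_minus, Inc; lra).
  exists (mkposreal _ (Rmin_pos _ _ Hr Hl)). intros z Hz.
  change (Rabs (z - y) < Rmin (f (u + pos eps / 2) - f u) (f u - f (u - pos eps / 2))) in Hz.
  destruct (Hsig z) as [v [Hv Ev]]. simpl.
  change (Rabs (v - u) < eps).
  pose proof (Hlip z y) as Hzy. rewrite <- Ev, <- Eu in Hzy.
  pose proof (Rmin_l (f (u + pos eps / 2) - f u) (f u - f (u - pos eps / 2))).
  pose proof (Rmin_r (f (u + pos eps / 2) - f u) (f u - f (u - pos eps / 2))).
  assert (Hfv : Rabs (f v - f u) < Rmin (f (u + pos eps / 2) - f u) (f u - f (u - pos eps / 2))) by lra.
  apply Rabs_def2 in Hfv. apply Rabs_def1.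
  + destruct (Rle_or_lt (u + pos eps / 2) v) as [H1|H1]; [apply Mon in H1|]; lra.
  + destruct (Rle_or_lt v (u - pos eps / 2)) as [H1|H1]; [apply Mon in H1|]; lra.
- intros y. destruct (Hsig y); simpl; tauto.
- intros y Hy. destruct (Hsig y) as [x [Hx E]]; simpl. rewrite E.
  unfold cl. rewrite Rmin_left, Rmax_right; lra.
Qed.

Lemma RInt_substitution (f g dg : R -> R) (a b : R) :
  (forall x, continuous f x) -> (forall x, is_derive g x (dg x)) -> (forall x, continuous dg x) ->
  RInt f (g a) (g b) = RInt (fun y => dg y * f (g y)) a b.
Proof.
intros Cf Dg Cdg. symmetry.
apply (RInt_comp (V := R_CompleteNormedModule) f g dg); auto.
Qed.

Lemma RInt_nonneg_mono (f : R -> R) (a b c d : R) :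
  (forall x, continuous f x) -> (forall x, 0 <= f x) ->
  a <= b -> b <= c -> c <= d -> RInt f b c <= RInt f a d.
Proof.
intros Cf Pf Hab Hbc Hcd.
assert (E : forall u v, ex_RInt f u v) by (intros; now apply ex_RInt_continuous_everywhere).
pose proof (RInt_Chasles (V := R_CompleteNormedModule) f a b d (E _ _) (E _ _)) as H1.
pose proof (RInt_Chasles (V := R_CompleteNormedModule) f b c d (E _ _) (E _ _)) as H2.
change (RInt f a b + RInt f b d = RInt f a d) in H1.
change (RInt f b c + RInt f c d = RInt f b d) in H2.
pose proof (RInt_ge_0 f a b Hab (E _ _) (fun x _ => Pf x)).
pose proof (RInt_ge_0 f c d Hcd (E _ _) (fun x _ => Pf x)). lra.
Qed.

(** * Timelike curves *)
Definition timelike (l d : R -> R) : Prop :=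
  (forall t, is_derive l t (d t)) /\ (forall t, continuous d t) /\ (forall t, -1 < d t < 1).

Lemma timelike_cone (l d : R -> R) (s t : R) :
  timelike l d -> s < t -> s - t < l t - l s < t - s.
Proof.
intros (Hl & _ & Hd) Hst.
destruct (MVT_cor2 l d s t Hst) as [c [E _]].
- intros c _. apply is_derive_Reals, Hl.
- pose proof (Hd c). rewrite E. nra.
Qed.

Lemma timelike_continuous (l d : R -> R) (t : R) : timelike l d -> continuous l t.
Proof.
intros (Hl & _). apply (ex_derive_continuous (V := R_NormedModule)). eexists; apply Hl.
Qed.

(** * Propagation along null rays *)
Lemma increment_le_oriented (F G : R -> R) (a b delta : R) :
  delta = 1 \/ delta = -1 -> 0 <= delta * (b - a) ->
  (forall s, continuous F s) -> (forall s, continuous G s) ->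
  (forall s, 0 < delta * (s - a) -> 0 < delta * (b - s) ->
     exists r g, is_derive F s r /\ is_derive G s g /\ Rabs r <= g) ->
  Rabs (F b - F a) <= delta * (G b - G a).
Proof.
intros [-> | ->] Hab CF CG HD.
- rewrite Rmult_1_l. apply increment_le; trivial; [lra|].
  intros s Hs. apply HD; lra.
- replace (-1 * (G b - G a)) with (G a - G b) by ring. rewrite Rabs_minus_sym.
  apply increment_le; trivial; [lra|]. intros s Hs. apply HD; lra.
Qed.

(** The increment of a quantity along a ray that arrives at time t, when its rate
    is bounded by an exponential weight growing towards t plus a density m
    carried by the rays of the other family. Integrating the weight gains a
    factor 1 / kappa, and the density integrates to its primitive M. The rays of
    the other family are labelled by 2 s - y: on the ray t + x = y (resp.
    t - x = y) this is the value of t - x (resp. t + x) at time s. *)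
Lemma weighted_increment (F m M : R -> R) (kappa delta d0 c1 c2 t s1 y : R) :
  delta = 1 \/ delta = -1 -> 0 <= delta * (t - s1) -> 0 < kappa -> 0 <= c1 ->
  (forall s, continuous F s) -> (forall z, is_derive M z (m z)) ->
  (forall s, 0 < delta * (s - s1) -> 0 < delta * (t - s) ->
     exists r, is_derive F s r /\
       Rabs r <= c1 * exp (kappa * (d0 - delta * (t - s))) + c2 * exp (kappa * d0) * m (2 * s - y)) ->
  Rabs (F t - F s1) <=
    exp (kappa * d0) * (c1 / kappa + c2 * (delta * (M (2 * t - y) - M (2 * s1 - y))) / 2).
Proof.
intros Hdelta Hts Hk Hc1 CF DM HD.
assert (Hd2 : delta * delta = 1) by (destruct Hdelta as [-> | ->]; ring).
set (G := fun s => delta * (c1 / kappa) * exp (kappa * (d0 - delta * (t - s)))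
                   + c2 / 2 * exp (kappa * d0) * M (2 * s - y)).
assert (DG : forall s, is_derive G s
   (c1 * exp (kappa * (d0 - delta * (t - s))) + c2 * exp (kappa * d0) * m (2 * s - y))).
{ intros s.
  replace (c1 * exp (kappa * (d0 - delta * (t - s))) + c2 * exp (kappa * d0) * m (2 * s - y))
    with ((delta * (c1 / kappa)) * (kappa * delta * exp (kappa * (d0 - delta * (t - s))))
          + (c2 / 2 * exp (kappa * d0)) * (2 * m (2 * s - y))).
  2:{ transitivity ((delta * delta) * c1 * exp (kappa * (d0 - delta * (t - s)))
        + c2 * exp (kappa * d0) * m (2 * s - y)).
      - field; lra.
      - rewrite Hd2; ring. }
  apply (is_derive_plus (V := R_NormedModule)).
  - apply (is_derive_scal (fun s => exp (kappa * (d0 - delta * (t - s))))).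
    auto_derive; trivial. unfold Rminus. ring.
  - apply (is_derive_scal (fun s => M (2 * s - y))).
    apply (is_derive_comp (V := R_NormedModule) M (fun s => 2 * s - y)); [apply DM|].
    auto_derive; trivial. ring. }
eapply Rle_trans.
- apply (increment_le_oriented F G s1 t delta); trivial.
  + intros s. apply (ex_derive_continuous (V := R_NormedModule)). eexists; apply DG.
  + intros s H1 H2. destruct (HD s H1 H2) as (r & Hr & Hle). eexists r, _.
    split; [exact Hr|]. split; [apply DG|exact Hle].
- unfold G. replace (d0 - delta * (t - t)) with d0 by ring.
  pose proof (exp_pos (kappa * (d0 - delta * (t - s1)))) as HE.
  assert (0 <= c1 / kappa) by (apply Rdiv_le_0_compat; lra).
  set (Es := exp (kappa * (d0 - delta * (t - s1)))) in *.
  set (E := exp (kappa * d0)) in *.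
  replace (delta * (delta * (c1 / kappa) * E + c2 / 2 * E * M (2 * t - y)
      - (delta * (c1 / kappa) * Es + c2 / 2 * E * M (2 * s1 - y))))
    with ((delta * delta) * (c1 / kappa * E) - (delta * delta) * (c1 / kappa * Es)
      + E * (c2 * (delta * (M (2 * t - y) - M (2 * s1 - y))) / 2)) by (field; lra).
  rewrite Hd2. nra.
Qed.

Definition jointly_continuous (f : R -> R -> R) : Prop :=
  forall z : R * R, continuous (fun z => f (fst z) (snd z)) z.

Lemma jointly_continuous_comp (f : R -> R -> R) (u v : R -> R) (s : R) :
  jointly_continuous f -> continuous u s -> continuous v s -> continuous (fun s => f (u s) (v s)) s.
Proof. intros Cf Cu Cv. apply (continuous_comp_2 u v f); trivial. Qed.

Lemma jointly_continuous_left_ray (f : R -> R -> R) (y s : R) :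
  jointly_continuous f -> continuous (fun s => f s (y - s)) s.
Proof.
intros Cf. apply (jointly_continuous_comp f (fun s => s) (fun s => y - s)); trivial.
- apply continuous_id.
- apply (ex_derive_continuous (V := R_NormedModule)). auto_derive. trivial.
Qed.

Lemma jointly_continuous_right_ray (f : R -> R -> R) (y s : R) :
  jointly_continuous f -> continuous (fun s => f s (s - y)) s.
Proof.
intros Cf. apply (jointly_continuous_comp f (fun s => s) (fun s => s - y)); trivial.
- apply continuous_id.
- apply (ex_derive_continuous (V := R_NormedModule)). auto_derive. trivial.
Qed.

Definition derivative_bounded (F : R -> R) (s b : R) : Prop :=
  exists r, is_derive F s r /\ Rabs r <= b.

Definition amplitude (p q phi : R -> R -> R) (t x : R) : R :=
  Rabs (p t x) + Rabs (q t x) + Rabs (phi t x).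

(** A linear function that increases at unit rate along t + x = const towards the
    future, and along t - x = const towards the future (delta = 1) or the past
    (delta = -1). It equals t for delta = 1 and -x for delta = -1, up to the
    constant gamma. *)
Definition depth (delta gamma t x : R) : R :=
  (1 + delta) / 2 * t + (delta - 1) / 2 * x + gamma.

Lemma depth_left (delta gamma t x s : R) :
  depth delta gamma s (t + x - s) = depth delta gamma t x - 1 * (t - s).
Proof. unfold depth. field. Qed.

Lemma depth_right (delta gamma t x s : R) :
  depth delta gamma s (s - (t - x)) = depth delta gamma t x - delta * (t - s).
Proof. unfold depth. field. Qed.

Lemma halving_iteration (P : R -> Prop) (A S0 : R) :
  0 <= S0 -> 0 <= A -> P S0 ->
  (forall S, 0 <= S -> P S -> P (A + S / 2)) -> 
  forall eps, 0 < eps -> exists S, 0 <= S <= 2 * A + eps /\ P S.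
Proof.
intros HS0 HA HP Hstep eps Heps.
assert (Hn : forall n, exists S, 0 <= S <= 2 * A + S0 * (/ 2) ^ n /\ P S).
{ induction n as [|n [S [[H1 H2] HPS]]].
  - exists S0. split; trivial. simpl; lra.
  - exists (A + S / 2). split; [|auto]. simpl. split; [lra|]. lra. }
destruct (pow_lt_1_zero (/ 2)) with (y := eps / (S0 + 1)) as [N HN].
- rewrite Rabs_pos_eq; lra.
- apply Rdiv_lt_0_compat; lra.
- destruct (Hn N) as [S [[H1 H2] HPS]]. exists S. split; trivial. split; trivial.
  specialize (HN N (le_n N)).
  assert (Hpw : 0 <= (/ 2) ^ N) by (apply pow_le; lra).
  rewrite Rabs_pos_eq in HN by trivial.
  apply (Rmult_lt_compat_l (S0 + 1)) in HN; [|lra].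
  replace ((S0 + 1) * (eps / (S0 + 1))) with eps in HN by (field; lra).
  nra.
Qed.

(** Bounds along rays from bounds where the rays start. In the region Om a ray of
    p is followed towards the future and a ray of q towards the future or the
    past, according to delta, so that the depth increases along both; q starts
    from data, or from a multiple of p (a reflection), and phi starts from zero.
    The functions mp of t + x and mq of t - x bound the data, and their masses
    along the rays that they cross are at most B. The proof turns a bound
    S W (mp + L B) for p, and similar ones for q and phi, into the same bound
    with A + S / 2 in place of S; iterating leaves 2 A. The lower order terms are
    small because an integral of the weight W gains 1 / kappa while the masses of
    mp and mq are at most 1 / L of the bound L B. The bound for q has an extra
    factor Gam = 4 k, so that a reflected value uses up only a quarter of it. *)
Lemma ray_propagation (K k F : R) :
  0 <= K -> 1 <= k -> 0 <= F ->
  exists C, 0 < C /\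
  forall (delta gamma A B : R) (Om : R -> R -> Prop) (p q phi : R -> R -> R)
    (mp mq Mp Mq : R -> R),
  delta = 1 \/ delta = -1 -> 0 <= A -> 0 < B ->
  (forall y, 0 <= mp y) -> (forall y, 0 <= mq y) ->
  (forall y, is_derive Mp y (mp y)) -> (forall y, is_derive Mq y (mq y)) ->
  jointly_continuous p -> jointly_continuous q -> jointly_continuous phi ->
  (exists S, forall t x, Om t x -> amplitude p q phi t x <= S) ->
  (forall t x, Om t x -> 0 <= depth delta gamma t x <= F) ->
  (forall t x, Om t x -> exists s0, s0 <= t /\
     Rabs (p s0 (t + x - s0)) <= A * (mp (t + x) + B) /\
     Mq (t - x) - Mq (2 * s0 - (t + x)) <= B /\
     (forall s, s0 < s < t -> Om s (t + x - s) /\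
        derivative_bounded (fun s => p s (t + x - s)) s (K * amplitude p q phi s (t + x - s)))) ->
  (forall t x, Om t x -> exists s1, 0 <= delta * (t - s1) /\
     (Rabs (q s1 (s1 - (t - x))) <= A * (mq (t - x) + B) \/
      (Om s1 (s1 - (t - x)) /\
       Rabs (q s1 (s1 - (t - x))) <= k * Rabs (p s1 (s1 - (t - x))) /\
       mp (2 * s1 - (t - x)) <= mq (t - x))) /\
     phi s1 (s1 - (t - x)) = 0 /\
     delta * (Mp (t + x) - Mp (2 * s1 - (t - x))) <= B /\
     (forall s, 0 < delta * (s - s1) -> 0 < delta * (t - s) ->
        Om s (s - (t - x)) /\
        derivative_bounded (fun s => q s (s - (t - x))) s (K * amplitude p q phi s (s - (t - x))) /\
        derivative_bounded (fun s => phi s (s - (t - x))) s (Rabs (p s (s - (t - x)))))) ->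
  forall t x, Om t x ->
    Rabs (p t x) <= C * A * (mp (t + x) + B) /\
    Rabs (q t x) <= C * A * (mq (t - x) + B) /\
    Rabs (phi t x) <= C * A * B.
Proof.
intros HK Hk HF.
set (Gam := 4 * k).
set (kappa := 8 * K * (2 + Gam) + 4).
set (L := 2 + 2 * K * Gam + 4 * K).
assert (HGam : 4 <= Gam) by (unfold Gam; lra).
assert (HKG : 0 <= K * (2 + Gam)) by nra.
assert (Hkappa : 4 <= kappa) by (unfold kappa; lra).
assert (HKG' : 0 <= K * Gam) by nra.
assert (HL : 2 <= L) by (unfold L; lra).
pose proof (exp_pos (kappa * F)) as HEF.
exists (2 * Gam * L * exp (kappa * F)). split; [repeat apply Rmult_lt_0_compat; lra|].
intros delta gamma A B Om p q phi mp mq Mp Mq Hdelta HA HB Pmp Pmq DMp DMq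
  Cp Cq Cphi [S0 HS0] Hdepth Hleft Hright.
set (W := fun t x => exp (kappa * depth delta gamma t x)).
assert (HLB : 2 * B <= L * B) by nra.
set (valid := fun S => forall t x, Om t x ->
   Rabs (p t x) <= S * W t x * (mp (t + x) + L * B) /\
   Rabs (q t x) <= S * Gam * W t x * (mq (t - x) + L * B) /\
   Rabs (phi t x) <= S * W t x * (L * B)).
assert (HW : forall t x, Om t x -> 1 <= W t x).
{ intros t x Ho. unfold W. rewrite <- exp_0. destruct (Hdepth t x Ho) as [H0 _].
  destruct (Req_dec (kappa * depth delta gamma t x) 0) as [->|Hne]; [lra|].
  apply Rlt_le, exp_increasing. nra. }
assert (HKk : K * (2 + Gam) / kappa <= / 8).
{ apply (Rmult_le_reg_r kappa); [lra|].
  replace (K * (2 + Gam) / kappa * kappa) with (K * (2 + Gam)) by (field; lra).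
  unfold kappa; lra. }
assert (Hk4 : / kappa <= / 4) by (apply Rinv_le_contravar; lra).
assert (HK8 : K / kappa <= / 8).
{ eapply Rle_trans; [|exact HKk]. apply Rmult_le_compat_r; [|nra].
  apply Rlt_le, Rinv_0_lt_compat; lra. }
(* where [E] bounds the weight, for instance at earlier points of a ray along
   which the weight has grown to [E], the densities carried by the other rays are
   weighted by the constant [E], so that they can be integrated separately *)
assert (Hrate : forall S t x, 0 <= S -> valid S -> Om t x -> forall E, W t x <= E ->
   amplitude p q phi t x <= S * (mp (t + x) + (2 + Gam) * (L * B)) * W t x + S * Gam * E * mq (t - x) /\
   amplitude p q phi t x <= S * (Gam * mq (t - x) + (2 + Gam) * (L * B)) * W t x + S * E * mp (t + x) /\
   Rabs (p t x) <= S * (L * B) * W t x + S * E * mp (t + x)).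
{ intros S t x HS HV Ho E HE. destruct (HV t x Ho) as (H1 & H2 & H3). unfold amplitude.
  assert (S * Gam * mq (t - x) * W t x <= S * Gam * mq (t - x) * E).
  { apply Rmult_le_compat_l; trivial. apply Rmult_le_pos; [nra|apply Pmq]. }
  assert (S * mp (t + x) * W t x <= S * mp (t + x) * E).
  { apply Rmult_le_compat_l; trivial. apply Rmult_le_pos; [nra|apply Pmp]. }
  split; [|split]; lra. }
assert (Hstep : forall S, 0 <= S -> valid S -> valid (A + S / 2)).
{ intros S HS HV t x Ho.
  pose proof (HW t x Ho) as HW1. pose proof (Pmp (t + x)) as Pp. pose proof (Pmq (t - x)) as Pq.
  split.
  - destruct (Hleft t x Ho) as (s0 & Hs0 & Hini & HM & Hpath).
    pose proof (weighted_increment (fun s => p s (t + x - s)) mq Mq kappa 1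
      (depth delta gamma t x) (K * (S * (mp (t + x) + (2 + Gam) * (L * B)))) (K * (S * Gam))
      t s0 (t + x)) as Hinc.
    cbv beta in Hinc. replace (t + x - t) with x in Hinc by ring.
    replace (2 * t - (t + x)) with (t - x) in Hinc by ring.
    fold (W t x) in Hinc.
    assert (Hb : Rabs (p t x - p s0 (t + x - s0)) <=
       W t x * (K * (S * (mp (t + x) + (2 + Gam) * (L * B))) / kappa
          + K * (S * Gam) * (1 * (Mq (t - x) - Mq (2 * s0 - (t + x)))) / 2)).
    { apply Hinc; auto; try lra.
      - apply Rmult_le_pos; trivial. apply Rmult_le_pos; nra.
      - intros s. now apply jointly_continuous_left_ray.
      - intros s H1 H2. destruct (Hpath s) as (Hos & r & Hr & Hle); [lra|].
        exists r. split; trivial.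
        assert (HWs : W s (t + x - s) <= W t x).
        { unfold W. rewrite depth_left. apply Rlt_le, exp_increasing. nra. }
        destruct (Hrate S s (t + x - s) HS HV Hos _ HWs) as (Hr1 & _).
        replace (s + (t + x - s)) with (t + x) in Hr1 by ring.
        replace (s - (t + x - s)) with (2 * s - (t + x)) in Hr1 by ring.
        rewrite <- depth_left. fold (W s (t + x - s)).
        apply (Rmult_le_compat_l K) in Hr1; [|lra]. lra. }
    clear Hinc.
    assert (Hpt : Rabs (p t x) <= Rabs (p s0 (t + x - s0)) + Rabs (p t x - p s0 (t + x - s0))).
    { replace (p t x) with (p s0 (t + x - s0) + (p t x - p s0 (t + x - s0))) at 1 by ring.
      apply Rabs_triang. }
    assert (H1 : K * (S * (mp (t + x) + (2 + Gam) * (L * B))) / kappa <= S / 8 * (mp (t + x) + L * B)).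
    { replace (K * (S * (mp (t + x) + (2 + Gam) * (L * B))) / kappa)
        with (S * (K / kappa * mp (t + x) + K * (2 + Gam) / kappa * (L * B))) by (field; lra).
      replace (S / 8 * (mp (t + x) + L * B)) with (S * (/ 8 * mp (t + x) + / 8 * (L * B))) by field.
      apply Rmult_le_compat_l; trivial.
      apply Rplus_le_compat; apply Rmult_le_compat_r; trivial; lra. }
    assert (H2 : K * (S * Gam) * (1 * (Mq (t - x) - Mq (2 * s0 - (t + x)))) / 2 <= S / 4 * (L * B)).
    { assert (K * (S * Gam) * (1 * (Mq (t - x) - Mq (2 * s0 - (t + x)))) <= K * (S * Gam) * B).
      { apply Rmult_le_compat_l; [nra|lra]. }
      assert (S * (2 * (K * Gam) * B) <= S * (L * B)).
      { apply Rmult_le_compat_l; trivial. apply Rmult_le_compat_r; [lra|]. unfold L; lra. }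
      lra. }
    assert (H3 : A * (mp (t + x) + B) <= A * W t x * (mp (t + x) + L * B)).
    { rewrite Rmult_assoc. apply Rmult_le_compat_l; trivial. nra. }
    assert (H4 : W t x * (K * (S * (mp (t + x) + (2 + Gam) * (L * B))) / kappa
          + K * (S * Gam) * (1 * (Mq (t - x) - Mq (2 * s0 - (t + x)))) / 2)
       <= W t x * (S / 2 * (mp (t + x) + L * B))).
    { apply Rmult_le_compat_l; [lra|]. assert (0 <= S * mp (t + x)) by nra.
      assert (0 <= S * (L * B)) by nra. lra. }
    lra.
  - destruct (Hright t x Ho) as (s1 & Hs1 & Hini & Hphi & HM & Hpath).
    set (z := s1 - (t - x)) in *.
    assert (Hrate1 : forall s, 0 < delta * (s - s1) -> 0 < delta * (t - s) ->
       let Ws := exp (kappa * (depth delta gamma t x - delta * (t - s))) in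
       K * amplitude p q phi s (s - (t - x)) <=
         K * (S * (Gam * mq (t - x) + (2 + Gam) * (L * B))) * Ws
         + K * S * W t x * mp (2 * s - (t - x)) /\
       Rabs (p s (s - (t - x))) <= S * (L * B) * Ws + S * W t x * mp (2 * s - (t - x))).
    { intros s H1 H2 Ws. destruct (Hpath s H1 H2) as (Hos & _).
      assert (HWs : W s (s - (t - x)) <= W t x).
      { unfold W. rewrite depth_right. apply Rlt_le, exp_increasing. nra. }
      destruct (Hrate S s (s - (t - x)) HS HV Hos _ HWs) as (_ & Hr1 & Hr2).
      replace (s + (s - (t - x))) with (2 * s - (t - x)) in Hr1, Hr2 by ring.
      replace (s - (s - (t - x))) with (t - x) in Hr1 by ring.
      assert (EW : W s (s - (t - x)) = Ws) by (unfold W, Ws; now rewrite depth_right).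
      rewrite EW in Hr1, Hr2. split; [|lra].
      apply (Rmult_le_compat_l K) in Hr1; [|lra]. lra. }
    assert (Etx : t - (t - x) = x) by ring.
    assert (Etx2 : 2 * t - (t - x) = t + x) by ring.
    split.
    + assert (Hb : Rabs (q t x - q s1 z) <=
         W t x * (K * (S * (Gam * mq (t - x) + (2 + Gam) * (L * B))) / kappa
          + K * S * (delta * (Mp (t + x) - Mp (2 * s1 - (t - x)))) / 2)).
      { pose proof (weighted_increment (fun s => q s (s - (t - x))) mp Mp kappa delta
          (depth delta gamma t x) (K * (S * (Gam * mq (t - x) + (2 + Gam) * (L * B)))) (K * S)
          t s1 (t - x)) as Hinc.
        cbv beta in Hinc. rewrite Etx, Etx2 in Hinc.
        apply Hinc; auto; try lra.
        - apply Rmult_le_pos; trivial. apply Rmult_le_pos; nra.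
        - intros s. now apply jointly_continuous_right_ray.
        - intros s H1 H2. destruct (Hpath s H1 H2) as (_ & (r & Hr & Hle) & _).
          exists r. split; trivial. destruct (Hrate1 s H1 H2) as (Hr1 & _).
          eapply Rle_trans; [exact Hle|exact Hr1]. }
      assert (Hqt : Rabs (q t x) <= Rabs (q s1 z) + Rabs (q t x - q s1 z)).
      { replace (q t x) with (q s1 z + (q t x - q s1 z)) at 1 by ring. apply Rabs_triang. }
      assert (H1 : K * (S * (Gam * mq (t - x) + (2 + Gam) * (L * B))) / kappa
                   <= S / 8 * (Gam * mq (t - x) + L * B)).
      { replace (K * (S * (Gam * mq (t - x) + (2 + Gam) * (L * B))) / kappa)
          with (S * (K / kappa * (Gam * mq (t - x)) + K * (2 + Gam) / kappa * (L * B))) by (field; lra).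
        replace (S / 8 * (Gam * mq (t - x) + L * B))
          with (S * (/ 8 * (Gam * mq (t - x)) + / 8 * (L * B))) by field.
        apply Rmult_le_compat_l; trivial.
        apply Rplus_le_compat; apply Rmult_le_compat_r; trivial; try lra.
        apply Rmult_le_pos; lra. }
      assert (H2 : K * S * (delta * (Mp (t + x) - Mp (2 * s1 - (t - x)))) / 2 <= S / 8 * (L * B)).
      { assert (K * S * (delta * (Mp (t + x) - Mp (2 * s1 - (t - x)))) <= K * S * B).
        { apply Rmult_le_compat_l; [nra|lra]. }
        assert (S * (4 * K * B) <= S * (L * B)).
        { apply Rmult_le_compat_l; trivial. apply Rmult_le_compat_r; [lra|]. unfold L; lra. }
        lra. }
      assert (H0 : 0 <= S * (Gam * mq (t - x))) by (apply Rmult_le_pos; nra).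
      assert (H0' : 0 <= S * (L * B)) by nra.
      assert (H4 : W t x * (K * (S * (Gam * mq (t - x) + (2 + Gam) * (L * B))) / kappa
          + K * S * (delta * (Mp (t + x) - Mp (2 * s1 - (t - x)))) / 2)
         <= W t x * (S / 4 * (Gam * mq (t - x) + Gam * (L * B)))).
      { apply Rmult_le_compat_l; [lra|]. assert (S * (L * B) * 1 <= S * (L * B) * Gam) by (apply Rmult_le_compat_l; lra). lra. }
      assert (H3 : Rabs (q s1 z) <= (A + S / 4) * Gam * W t x * (mq (t - x) + L * B)).
      { assert (Hmq : 0 <= mq (t - x) + L * B) by lra.
        destruct Hini as [Hd|(Hos & Hd & Hm)].
        - assert (A * (mq (t - x) + B) <= A * (Gam * W t x * (mq (t - x) + L * B))).
          { apply Rmult_le_compat_l; trivial. 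
            assert (1 * 1 <= Gam * W t x) by (apply Rmult_le_compat; lra). nra. }
          assert (0 <= S / 4 * (Gam * W t x * (mq (t - x) + L * B))).
          { apply Rmult_le_pos; [lra|]. apply Rmult_le_pos; [nra|lra]. }
          lra.
        - destruct (HV s1 z Hos) as (Hp & _).
          assert (HWs : W s1 z <= W t x).
          { unfold W, z. rewrite depth_right. destruct Hs1 as [Hs1|Hs1].
            - apply Rlt_le, exp_increasing. nra.
            - rewrite <- Hs1. right. f_equal. ring. }
          replace (s1 + z) with (2 * s1 - (t - x)) in Hp by (unfold z; ring).
          pose proof (Pmp (2 * s1 - (t - x))).
          assert (0 < W s1 z) by apply exp_pos.
          assert (S * (W s1 z * (mp (2 * s1 - (t - x)) + L * B)) <= S * (W t x * (mq (t - x) + L * B))).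
          { apply Rmult_le_compat_l; trivial. apply Rmult_le_compat; lra. }
          assert (k * Rabs (p s1 z) <= k * (S * (W t x * (mq (t - x) + L * B)))).
          { apply Rmult_le_compat_l; lra. }
          assert (0 <= A * (Gam * W t x * (mq (t - x) + L * B))).
          { apply Rmult_le_pos; [lra|]. apply Rmult_le_pos; [nra|lra]. }
          unfold Gam in *. lra. }
      lra.
    + assert (Hb : Rabs (phi t x - phi s1 z) <=
         W t x * (S * (L * B) / kappa
          + S * (delta * (Mp (t + x) - Mp (2 * s1 - (t - x)))) / 2)).
      { pose proof (weighted_increment (fun s => phi s (s - (t - x))) mp Mp kappa delta
          (depth delta gamma t x) (S * (L * B)) S t s1 (t - x)) as Hinc.
        cbv beta in Hinc. rewrite Etx, Etx2 in Hinc.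
        apply Hinc; auto; try lra.
        - nra.
        - intros s. now apply jointly_continuous_right_ray.
        - intros s H1 H2. destruct (Hpath s H1 H2) as (_ & _ & (r & Hr & Hle)).
          exists r. split; trivial. destruct (Hrate1 s H1 H2) as (_ & Hr1).
          eapply Rle_trans; [exact Hle|exact Hr1]. }
      rewrite Hphi, Rminus_0_r in Hb.
      assert (H0' : 0 <= S * (L * B)) by nra.
      assert (H1 : S * (L * B) / kappa <= S * (L * B) / 4) by (apply Rmult_le_compat_l; lra).
      assert (H2 : S * (delta * (Mp (t + x) - Mp (2 * s1 - (t - x)))) <= S * (L * B / 2)).
      { apply Rmult_le_compat_l; lra. }
      assert (H4 : W t x * (S * (L * B) / kappa + S * (delta * (Mp (t + x) - Mp (2 * s1 - (t - x)))) / 2)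
                   <= W t x * (S / 2 * (L * B))) by (apply Rmult_le_compat_l; lra).
      assert (0 <= A * (W t x * (L * B))) by (apply Rmult_le_pos; [lra|nra]).
      lra. }
(* the iteration starts from the qualitative bound [S0], which leaves no trace
   in the constant *)
assert (Hini : valid (Rabs S0 / (L * B))).
{ intros t x Ho. pose proof (HS0 t x Ho) as H0. unfold amplitude in H0.
  pose proof (Rle_abs S0). pose proof (HW t x Ho).
  pose proof (Rabs_pos (p t x)). pose proof (Rabs_pos (q t x)). pose proof (Rabs_pos (phi t x)).
  pose proof (Pmp (t + x)). pose proof (Pmq (t - x)).
  assert (HP : 0 <= Rabs S0 / (L * B)) by (apply Rdiv_le_0_compat; [apply Rabs_pos|nra]).
  assert (HP' : Rabs S0 / (L * B) * (L * B) = Rabs S0) by (field; nra).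
  assert (HH : forall w m, 1 <= w -> 0 <= m -> Rabs S0 <= Rabs S0 / (L * B) * w * (m + L * B)).
  { intros w m Hw Hm. rewrite <- HP' at 1. rewrite Rmult_assoc. apply Rmult_le_compat_l; trivial. nra. }
  assert (1 * 1 <= Gam * W t x) by (apply Rmult_le_compat; lra).
  split; [|split].
  - eapply Rle_trans; [|apply HH; trivial]. lra.
  - rewrite Rmult_assoc with (r2 := Gam). eapply Rle_trans; [|apply HH; trivial; lra]. lra.
  - eapply Rle_trans; [|rewrite <- (Rplus_0_l (L * B)) at 2; apply HH; trivial; lra]. lra. }
intros t x Ho.
assert (HP : 0 <= Rabs S0 / (L * B)) by (apply Rdiv_le_0_compat; [apply Rabs_pos|nra]).
pose proof (halving_iteration valid A _ HP HA Hini Hstep) as Hit.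
pose proof (HW t x Ho) as HW1.
assert (HWF : W t x <= exp (kappa * F)).
{ unfold W. destruct (Hdepth t x Ho) as [_ Hd].
  destruct (Req_dec (depth delta gamma t x) F) as [->|Hne]; [lra|].
  apply Rlt_le, exp_increasing. nra. }
assert (Hlim : forall u v w : R, 0 <= v -> (forall S, valid S -> 0 <= S -> u <= S * v) -> 
   v <= w -> u <= 2 * A * w).
{ intros u v w Hv Hu Hvw. apply Rle_trans with (2 * A * v); [|apply Rmult_le_compat_l; lra].
  apply le_epsilon. intros eps Heps.
  destruct (Hit (eps / (v + 1))) as (S & HSb & HVS); [apply Rdiv_lt_0_compat; lra|].
  eapply Rle_trans; [apply (Hu S HVS); lra|].
  assert (eps / (v + 1) * (v + 1) = eps) by (field; lra).
  assert (0 < eps / (v + 1)) by (apply Rdiv_lt_0_compat; lra).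
  assert (S * v <= (2 * A + eps / (v + 1)) * v) by (apply Rmult_le_compat_r; lra). lra. }
pose proof (Pmp (t + x)) as Pp. pose proof (Pmq (t - x)) as Pq.
assert (Hmaj : forall m, 0 <= m -> m + L * B <= L * (m + B)) by (intros; nra).
assert (Hfin : forall v m, 0 <= v <= Gam * W t x -> 0 <= m -> v * (m + L * B) <= Gam * L * exp (kappa * F) * (m + B)).
{ intros v m Hv Hm.
  apply Rle_trans with (Gam * exp (kappa * F) * (L * (m + B))); [|lra].
  apply Rmult_le_compat; try lra; [|auto].
  eapply Rle_trans; [apply Hv|]. apply Rmult_le_compat_l; lra. }
assert (HWG : W t x <= Gam * W t x) by nra.
repeat split.
- replace (2 * Gam * L * exp (kappa * F) * A * (mp (t + x) + B))
    with (2 * A * (Gam * L * exp (kappa * F) * (mp (t + x) + B))) by ring.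
  apply Hlim with (W t x * (mp (t + x) + L * B)); [nra| |apply Hfin; lra].
  intros S HVS _. destruct (HVS t x Ho) as (H & _). lra.
- replace (2 * Gam * L * exp (kappa * F) * A * (mq (t - x) + B))
    with (2 * A * (Gam * L * exp (kappa * F) * (mq (t - x) + B))) by ring.
  apply Hlim with (Gam * W t x * (mq (t - x) + L * B)); [| |apply Hfin; lra].
  + apply Rmult_le_pos; nra.
  + intros S HVS _. destruct (HVS t x Ho) as (_ & H & _). lra.
- replace (2 * Gam * L * exp (kappa * F) * A * B)
    with (2 * A * (Gam * L * exp (kappa * F) * (0 + B))) by ring.
  apply Hlim with (W t x * (0 + L * B)); [nra| |apply Hfin; lra].
  intros S HVS _. destruct (HVS t x Ho) as (_ & _ & H). lra.
Qed.

(** * Compactness and changes of variables *)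

(** By uniform continuity f changes by less than 1 on each of N + 1 equal steps of
    the segment from the corner (a, c) to (t, x), with N independent of (t, x). *)
Lemma jointly_continuous_bounded (f : R -> R -> R) (a b c d : R) :
  jointly_continuous f -> a <= b -> c <= d ->
  exists M, forall t x, a <= t <= b -> c <= x <= d -> Rabs (f t x) <= M.
Proof.
intros Cf Hab Hcd.
destruct (uniform_continuity_2d f a b c d) with (eps := mkposreal 1 Rlt_0_1) as [del Hdel].
{ intros x y _ _. apply continuity_2d_pt_filterlim. apply Cf. }
set (len := (b - a) + (d - c) + 1).
destruct (nfloor_ex (len / del)) as [N [_ HN]].
{ apply Rdiv_le_0_compat; [unfold len; lra|apply cond_pos]. }
assert (HN1 : 0 < INR N + 1) by (pose proof (pos_INR N); lra).
assert (Hsmall : len / (INR N + 1) < del).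
{ pose proof (cond_pos del) as Hd.
  apply (Rmult_lt_reg_r (INR N + 1)); trivial.
  replace (len / (INR N + 1) * (INR N + 1)) with len by (field; lra).
  apply (Rmult_lt_compat_r del) in HN; trivial.
  replace (len / del * del) with len in HN by (field; lra). lra. }
exists (Rabs (f a c) + (INR N + 1)). intros t x Ht Hx.
set (u := fun n => a + INR n * ((t - a) / (INR N + 1))).
set (v := fun n => c + INR n * ((x - c) / (INR N + 1))).
assert (Hfrac : forall n y, (n <= S N)%nat -> 0 <= y -> 0 <= INR n * (y / (INR N + 1)) <= y).
{ intros n y Hn Hy. apply le_INR in Hn. rewrite S_INR in Hn. pose proof (pos_INR n).
  assert (0 <= y / (INR N + 1)) by (apply Rdiv_le_0_compat; lra).
  split; [nra|]. replace y with ((INR N + 1) * (y / (INR N + 1))) at 2 by (field; lra).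
  apply Rmult_le_compat_r; lra. }
assert (Hind : forall n, (n <= S N)%nat -> Rabs (f (u n) (v n)) <= Rabs (f a c) + INR n).
{ induction n as [|n IH]; intros Hn.
  - unfold u, v. simpl. rewrite !Rmult_0_l, !Rplus_0_r. lra.
  - assert (Hn' : (n <= S N)%nat) by (apply le_S_n; apply le_S; exact Hn).
    specialize (IH Hn').
    assert (Hstep : forall y, 0 <= y <= len -> Rabs (y / (INR N + 1)) < del).
    { intros y Hy. rewrite Rabs_pos_eq by (apply Rdiv_le_0_compat; lra).
      eapply Rle_lt_trans; [|exact Hsmall]. apply Rmult_le_compat_r; [|lra].
      apply Rlt_le, Rinv_0_lt_compat; lra. }
    pose proof (Hfrac n (t - a) Hn') as A1. pose proof (Hfrac (S n) (t - a) Hn) as A2.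
    pose proof (Hfrac n (x - c) Hn') as A3. pose proof (Hfrac (S n) (x - c) Hn) as A4.
    assert (H := Hdel (u n) (v n) (u (S n)) (v (S n))).
    assert (Hlt : Rabs (f (u (S n)) (v (S n)) - f (u n) (v n)) < 1).
    { apply H; unfold u, v; try lra.
      - replace (_ - _) with ((t - a) / (INR N + 1)) by (rewrite S_INR; ring).
        apply Hstep. unfold len; lra.
      - replace (_ - _) with ((x - c) / (INR N + 1)) by (rewrite S_INR; ring).
        apply Hstep. unfold len; lra. }
    rewrite S_INR.
    replace (f (u (S n)) (v (S n))) with
      (f (u n) (v n) + (f (u (S n)) (v (S n)) - f (u n) (v n))) by ring.
    eapply Rle_trans; [apply Rabs_triang|]. lra. }
specialize (Hind (S N) (le_n _)). rewrite S_INR in Hind.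
replace (u (S N)) with t in Hind by (unfold u; rewrite S_INR; field; lra).
replace (v (S N)) with x in Hind by (unfold v; rewrite S_INR; field; lra).
exact Hind.
Qed.

Definition inverse_on (f : R -> R) (a b : R) (sigma : R -> R) : Prop :=
  (forall y, continuous sigma y) /\ (forall y, a <= sigma y <= b) /\
  (forall y, f a <= y <= f b -> f (sigma y) = y).

Lemma inverse_on_cancel (f sigma : R -> R) (a b s : R) :
  inverse_on f a b sigma -> (forall s t, s < t -> f s < f t) ->
  a <= s <= b -> sigma (f s) = s.
Proof.
intros (_ & _ & Hs) Inc H.
assert (E : f (sigma (f s)) = f s).
{ apply Hs. split; [destruct (proj1 H) as [H1| ->]|destruct (proj2 H) as [H1| ->]];
    try (apply Rlt_le, Inc, H1); lra. }
destruct (Rtotal_order (sigma (f s)) s) as [H1|[H1|H1]]; trivial;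
  apply Inc in H1; lra.
Qed.

(** The substitution y = f s turns the left hand side into the integral of df g,
    which [g2] dominates. *)
Lemma inverse_on_mass (f df sigma g g2 : R -> R) (a b u v : R) :
  inverse_on f a b sigma -> (forall s t, s < t -> f s < f t) ->
  (forall s, is_derive f s (df s)) -> (forall s, continuous df s) ->
  (forall y, continuous g y) -> (forall y, 0 <= g y) -> (forall s, continuous g2 s) ->
  (forall s, a <= s <= b -> df s * g s <= g2 s) ->
  f a <= u -> u <= v -> v <= f b -> a <= b ->
  RInt (fun y => g (sigma y)) u v <= RInt g2 a b.
Proof.
intros Hsig Inc Df Cdf Cg Pg Cg2 Hle Hu Huv Hv Hab.
assert (Cgs : forall y, continuous (fun y => g (sigma y)) y).
{ intros y. apply (continuous_comp sigma g); [apply Hsig|apply Cg]. }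
eapply Rle_trans.
- apply (RInt_nonneg_mono (fun y => g (sigma y)) (f a) u v (f b)); auto.
- rewrite (RInt_substitution _ f df) by trivial.
  apply RInt_le; trivial; [| |].
  + apply ex_RInt_continuous_everywhere. intros s.
    apply (continuous_mult (K := R_AbsRing) df (fun y => g (sigma (f y)))); [apply Cdf|].
    apply (continuous_comp f (fun y => g (sigma y))); [|apply Cgs].
    apply (ex_derive_continuous (V := R_NormedModule)). eexists; apply Df.
  + now apply ex_RInt_continuous_everywhere.
  + intros s Hs. rewrite (inverse_on_cancel f sigma a b s Hsig Inc) by lra. apply Hle; lra.
Qed.

(** * Characteristic systems *)

(** What the estimates use of a solution: p and q stand for phi_t + phi_x and
    phi_t - phi_x, and h for phi_x on the right curve. Everything is an
    inequality between absolute values, so that time reversal, which exchanges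
    p and q, preserves it. *)
Record characteristic_system (l1 l2 : R -> R) (a b K k : R) (p q phi : R -> R -> R)
    (h : R -> R) : Prop := {
  cs_p : jointly_continuous p;
  cs_q : jointly_continuous q;
  cs_phi : jointly_continuous phi;
  cs_h : forall t, continuous h t;
  cs_left : forall y s, a < s < b -> l1 s < y - s < l2 s ->
    derivative_bounded (fun s => p s (y - s)) s (K * amplitude p q phi s (y - s)) /\
    derivative_bounded (fun s => phi s (y - s)) s (Rabs (q s (y - s)));
  cs_right : forall y s, a < s < b -> l1 s < s - y < l2 s ->
    derivative_bounded (fun s => q s (s - y)) s (K * amplitude p q phi s (s - y)) /\
    derivative_bounded (fun s => phi s (s - y)) s (Rabs (p s (s - y)));
  cs_phi1 : forall t, phi t (l1 t) = 0;
  cs_phi2 : forall t, phi t (l2 t) = 0;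
  cs_q1 : forall t, a <= t <= b -> Rabs (q t (l1 t)) <= k * Rabs (p t (l1 t));
  cs_p1 : forall t, a <= t <= b -> Rabs (p t (l1 t)) <= k * Rabs (q t (l1 t));
  cs_p2 : forall t, Rabs (p t (l2 t)) <= 2 * Rabs (h t);
  cs_q2 : forall t, Rabs (q t (l2 t)) <= 2 * Rabs (h t)
}.
Arguments cs_left {l1 l2 a b K k p q phi h} _.
Arguments cs_right {l1 l2 a b K k p q phi h} _.
Arguments cs_q1 {l1 l2 a b K k p q phi h} _.
Arguments cs_p2 {l1 l2 a b K k p q phi h} _.
Arguments cs_q2 {l1 l2 a b K k p q phi h} _.
Arguments cs_h {l1 l2 a b K k p q phi h} _.

Lemma timelike_plus (l d : R -> R) : timelike l d ->
  (forall s, continuous (fun s => s + l s) s) /\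
  (forall s, is_derive (fun s => s + l s) s (1 + d s)) /\
  (forall s, continuous (fun s => 1 + d s) s) /\
  (forall s t, s < t -> s + l s < t + l t).
Proof.
intros Hl. split; [|split; [|split]].
- intros s. apply (continuous_plus (V := R_NormedModule)); [apply continuous_id|].
  now apply (timelike_continuous l d).
- intros s. apply (is_derive_plus (V := R_NormedModule) (fun s => s)); [apply (is_derive_id (K := R_AbsRing))|apply Hl].
- intros s. apply (continuous_plus (V := R_NormedModule)); [apply continuous_const|apply Hl].
- intros s t Hst. pose proof (timelike_cone l d s t Hl Hst). lra.
Qed.

Lemma timelike_minus (l d : R -> R) : timelike l d ->
  (forall s, continuous (fun s => s - l s) s) /\
  (forall s, is_derive (fun s => s - l s) s (1 - d s)) /\
  (forall s, continuous (fun s => 1 - d s) s) /\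
  (forall s t, s < t -> s - l s < t - l t).
Proof.
intros Hl. split; [|split; [|split]].
- intros s. apply (continuous_minus (V := R_NormedModule)); [apply continuous_id|].
  now apply (timelike_continuous l d).
- intros s. apply (is_derive_minus (V := R_NormedModule) (fun s => s)); [apply (is_derive_id (K := R_AbsRing))|apply Hl].
- intros s. apply (continuous_minus (V := R_NormedModule)); [apply continuous_const|apply Hl].
- intros s t Hst. pose proof (timelike_cone l d s t Hl Hst). lra.
Qed.

Lemma increasing_le (f : R -> R) (s t : R) :
  (forall s t, s < t -> f s < f t) -> s <= t -> f s <= f t.
Proof. intros Inc [H| ->]; [apply Rlt_le, Inc, H|lra]. Qed.

Lemma increasing_le_inv (f : R -> R) (s t : R) :
  (forall s t, s < t -> f s < f t) -> f s <= f t -> s <= t.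
Proof. intros Inc H. destruct (Rle_or_lt s t) as [H1|H1]; trivial. apply Inc in H1; lra. Qed.

Lemma RInt_primitive (f : R -> R) (c : R) :
  (forall y, continuous f y) -> forall y, is_derive (fun y => RInt f c y) y (f y).
Proof.
intros Cf y. apply (is_derive_RInt (V := R_NormedModule) f (fun y => RInt f c y) c).
- apply filter_forall. intros z. apply (RInt_correct (V := R_CompleteNormedModule)).
  now apply ex_RInt_continuous_everywhere.
- apply Cf.
Qed.

Lemma RInt_primitive_diff (f : R -> R) (c y z : R) :
  (forall y, continuous f y) -> RInt f c z - RInt f c y = RInt f y z.
Proof.
intros Cf.
assert (E : forall u v, ex_RInt f u v) by (intros; now apply ex_RInt_continuous_everywhere).
pose proof (RInt_Chasles (V := R_CompleteNormedModule) f c y z (E _ _) (E _ _)) as H.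
change (RInt f c y + RInt f y z = RInt f c z) in H. lra.
Qed.

Lemma slab_bound (l1 d1 l2 d2 : R -> R) (a b t x : R) :
  timelike l1 d1 -> timelike l2 d2 -> a <= t <= b -> l1 t <= x <= l2 t ->
  l1 a - (b - a) <= x <= l2 a + (b - a).
Proof.
intros H1 H2 Ht Hx. destruct (proj1 Ht) as [Hlt|<-]; [|lra].
pose proof (timelike_cone _ _ a t H1 Hlt). pose proof (timelike_cone _ _ a t H2 Hlt). lra.
Qed.

Lemma system_bounded (l1 d1 l2 d2 : R -> R) (a b : R) (p q phi : R -> R -> R) :
  timelike l1 d1 -> timelike l2 d2 -> a <= b -> l1 a < l2 a ->
  jointly_continuous p -> jointly_continuous q -> jointly_continuous phi ->
  exists S, forall t x, a <= t <= b -> l1 t <= x <= l2 t -> amplitude p q phi t x <= S.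
Proof.
intros H1 H2 Hab Hl Cp Cq Cphi.
destruct (jointly_continuous_bounded p a b (l1 a - (b - a)) (l2 a + (b - a)) Cp) as [M1 HM1]; try lra.
destruct (jointly_continuous_bounded q a b (l1 a - (b - a)) (l2 a + (b - a)) Cq) as [M2 HM2]; try lra.
destruct (jointly_continuous_bounded phi a b (l1 a - (b - a)) (l2 a + (b - a)) Cphi) as [M3 HM3]; try lra.
exists (M1 + M2 + M3). intros t x Ht Hx.
pose proof (slab_bound l1 d1 l2 d2 a b t x H1 H2 Ht Hx) as Hx'. unfold amplitude.
specialize (HM1 t x Ht Hx'). specialize (HM2 t x Ht Hx'). specialize (HM3 t x Ht Hx'). lra.
Qed.

(** The zigzag of null rays: leftward from the right curve at time a to the left
    curve at time m, then rightward back to the right curve at time e. *)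
Definition two_ray_geometry (l1 d1 l2 d2 : R -> R) (a m e b : R) : Prop :=
  timelike l1 d1 /\ timelike l2 d2 /\ (forall t, l1 t < l2 t) /\
  a + l2 a = m + l1 m /\ m - l1 m = e - l2 e /\ e <= b.

(** A null ray that joins the two curves in the wrong order of times would have to
    leave the light cone of one of them. *)
Lemma two_ray_order (l1 d1 l2 d2 : R -> R) (a m e b : R) :
  two_ray_geometry l1 d1 l2 d2 a m e b -> a < m < e.
Proof.
intros (T1 & T2 & Hl & Ha & He & _).
destruct (timelike_plus _ _ T1) as (_ & _ & _ & I1).
destruct (timelike_minus _ _ T1) as (_ & _ & _ & I2).
pose proof (Hl a). pose proof (Hl e). split; apply Rnot_le_lt; intros Hc.
- pose proof (increasing_le (fun s => s + l1 s) m a I1 Hc). simpl in *. lra.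
- pose proof (increasing_le (fun s => s - l1 s) e m I2 Hc). simpl in *. lra.
Qed.

(** * Pointwise bounds by the boundary data *)

(** The sideways problem in the triangle between the right curve and the zigzag:
    from each of its points the p-ray backward in time and the q-ray forward in
    time lead to the right curve at times between a and e, and x increases along
    both. So the depth is -x, that is delta = -1, and there is no reflection. *)
Lemma inner_estimate (l1 d1 l2 d2 : R -> R) (a m e b K : R) :
  two_ray_geometry l1 d1 l2 d2 a m e b -> 0 <= K ->
  exists C, 0 < C /\
  forall (sp sm : R -> R) (k B : R) (p q phi : R -> R -> R) (h : R -> R),
  inverse_on (fun s => s + l2 s) a b sp -> inverse_on (fun s => s - l2 s) a e sm ->
  characteristic_system l1 l2 a b K k p q phi h ->
  0 < B -> RInt (fun t => Rabs (h t)) a b <= B ->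
  forall t x, a <= t <= b -> l1 t <= x <= l2 t -> a + l2 a <= t + x -> t - x <= e - l2 e ->
  Rabs (p t x) <= C * (Rabs (h (sp (t + x))) + B).
Proof.
intros G HK. pose proof (two_ray_order _ _ _ _ _ _ _ _ G) as Hord.
destruct G as (T1 & T2 & Hl & Ha & He & Heb).
destruct (timelike_plus _ _ T2) as (C2p & D2p & C2p' & I2p).
destruct (timelike_minus _ _ T2) as (C2m & D2m & C2m' & I2m).
destruct (ray_propagation K 1 (l2 a - l1 a + 2 * (b - a)) HK) as (C & HC & HP);
  [lra|pose proof (Hl a); lra|].
exists (4 * C). split; [lra|].
intros sp sm k B p q phi h Hsp Hsm HS HB HhB t0 x0 Ht0 Hx0 Hxi0 Heta0.
set (mp := fun y => 2 * Rabs (h (sp y))). set (mq := fun y => 2 * Rabs (h (sm y))).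
assert (Ch : forall y, continuous (fun y => 2 * Rabs (h y)) y).
{ intros y. apply continuous_cmul, continuous_Rabs_comp, HS. }
assert (Ch4 : forall y, continuous (fun y => 4 * Rabs (h y)) y).
{ intros y. apply continuous_cmul, continuous_Rabs_comp, HS. }
assert (Cmp : forall y, continuous mp y).
{ intros y. apply (continuous_comp sp (fun y => 2 * Rabs (h y))); [apply Hsp|apply Ch]. }
assert (Cmq : forall y, continuous mq y).
{ intros y. apply (continuous_comp sm (fun y => 2 * Rabs (h y))); [apply Hsm|apply Ch]. }
assert (H4 : RInt (fun y => 4 * Rabs (h y)) a b <= 4 * B).
{ rewrite RInt_cmul; [lra|]. intros y. apply continuous_Rabs_comp, HS. }
assert (Hmp : forall u v, a + l2 a <= u -> u <= v -> v <= b + l2 b -> RInt mp u v <= 4 * B).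
{ intros u v Hu Huv Hv. eapply Rle_trans; [|exact H4].
  apply (inverse_on_mass (fun s => s + l2 s) (fun s => 1 + d2 s) sp
     (fun y => 2 * Rabs (h y)) (fun y => 4 * Rabs (h y)) a b u v); auto; try lra.
  - intros y. pose proof (Rabs_pos (h y)); lra.
  - intros s _. destruct T2 as (_ & _ & Hd). pose proof (Hd s). pose proof (Rabs_pos (h s)). nra. }
assert (Hmq : forall u v, a - l2 a <= u -> u <= v -> v <= e - l2 e -> RInt mq u v <= 4 * B).
{ intros u v Hu Huv Hv. apply Rle_trans with (RInt (fun y => 4 * Rabs (h y)) a e).
  - apply (inverse_on_mass (fun s => s - l2 s) (fun s => 1 - d2 s) sm
      (fun y => 2 * Rabs (h y)) (fun y => 4 * Rabs (h y)) a e u v); auto; try lra.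
    + intros y. pose proof (Rabs_pos (h y)); lra.
    + intros s _. destruct T2 as (_ & _ & Hd). pose proof (Hd s). pose proof (Rabs_pos (h s)). nra.
  - eapply Rle_trans; [|exact H4]. apply RInt_nonneg_mono; auto; try lra.
    intros y. pose proof (Rabs_pos (h y)); lra. }
set (Om := fun t x => a <= t <= b /\ l1 t <= x <= l2 t /\ a + l2 a <= t + x /\ t - x <= e - l2 e).
assert (Hgoal : Rabs (p t0 x0) <= C * 1 * (mp (t0 + x0) + 4 * B)).
{ apply (HP (-1) (l2 a + (b - a)) 1 (4 * B) Om p q phi mp mq
     (fun y => RInt mp 0 y) (fun y => RInt mq 0 y)); try lra.
  - intros y. unfold mp. pose proof (Rabs_pos (h (sp y))). lra.
  - intros y. unfold mq. pose proof (Rabs_pos (h (sm y))). lra.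
  - now apply RInt_primitive.
  - now apply RInt_primitive.
  - apply HS.
  - apply HS.
  - apply HS.
  - destruct (system_bounded l1 d1 l2 d2 a b p q phi) as [S HSb]; auto; try lra; try apply HS.
    exists S. intros t x (Ht & Hx & _). auto.
  - intros t x (Ht & Hx & _). pose proof (slab_bound _ _ _ _ a b t x T1 T2 Ht Hx).
    unfold depth. lra.
  - intros t x (Ht & Hx & Hxi & Heta).
    set (s0 := sp (t + x)).
    assert (Hs0b : a <= s0 <= b) by apply Hsp.
    assert (Hs0 : s0 + l2 s0 = t + x).
    { apply Hsp. split; trivial. pose proof (increasing_le (fun s => s + l2 s) t b I2p). simpl in *; lra. }
    assert (Hle : s0 <= t) by (apply (increasing_le_inv (fun s => s + l2 s)); simpl; trivial; lra).
    exists s0. split; trivial. split; [|split].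
    + replace (t + x - s0) with (l2 s0) by lra. unfold mp. fold s0.
      pose proof (cs_p2 HS s0). lra.
    + rewrite RInt_primitive_diff by trivial. apply Hmq; try lra.
      pose proof (increasing_le (fun s => s - l2 s) a s0 I2m). simpl in *; lra.
    + intros s Hs. pose proof (I2p s0 s (proj1 Hs)) as Hs2.
      pose proof (timelike_cone _ _ s t T1 (proj2 Hs)) as Hc.
      split; [unfold Om; lra|].
      apply (cs_left HS (t + x) s); lra.
  - intros t x (Ht & Hx & Hxi & Heta).
    set (s1 := sm (t - x)).
    assert (Hs1b : a <= s1 <= e) by apply Hsm.
    assert (Hs1 : s1 - l2 s1 = t - x).
    { apply Hsm. split; trivial. pose proof (increasing_le (fun s => s - l2 s) a t I2m). simpl in *; lra. }
    assert (Hle : t <= s1) by (apply (increasing_le_inv (fun s => s - l2 s)); simpl; trivial; lra).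
    exists s1. split; [lra|].
    replace (s1 - (t - x)) with (l2 s1) by lra. split; [left|split; [|split]].
    + unfold mq. fold s1. pose proof (cs_q2 HS s1). lra.
    + apply HS.
    + replace (-1 * (RInt mp 0 (t + x) - RInt mp 0 (2 * s1 - (t - x))))
        with (RInt mp 0 (2 * s1 - (t - x)) - RInt mp 0 (t + x)) by ring.
      rewrite RInt_primitive_diff by trivial. apply Hmp; try lra.
      pose proof (increasing_le (fun s => s + l2 s) s1 b I2p). simpl in *; lra.
    + intros s Hs Hs'.
      assert (Hlt1 : s < s1) by lra. assert (Hlt2 : t < s) by lra.
      pose proof (I2m s s1 Hlt1) as Hs2.
      pose proof (timelike_cone _ _ t s T1 Hlt2) as Hc.
      split; [unfold Om; lra|].
      apply (cs_right HS (t - x) s); lra.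
  - unfold Om. lra. }
unfold mp in Hgoal. pose proof (Rabs_pos (h (sp (t0 + x0)))).
assert (C * 1 * (2 * Rabs (h (sp (t0 + x0))) + 4 * B) <= C * (4 * (Rabs (h (sp (t0 + x0))) + B)))
  by (rewrite Rmult_1_r; apply Rmult_le_compat_l; lra).
lra.
Qed.

Lemma RInt_reflect (f : R -> R) (c u v : R) :
  (forall x, continuous f x) -> RInt (fun x => f (c - x)) u v = RInt f (c - v) (c - u).
Proof.
intros Cf.
assert (Cc : forall x, continuous (fun x => f (c - x)) x).
{ intros x. apply (continuous_comp (fun x => c - x) f); [|apply Cf].
  apply (ex_derive_continuous (V := R_NormedModule)). auto_derive; trivial. }
rewrite <- (opp_RInt_swap (V := R_CompleteNormedModule) f (c - u) (c - v)) by now apply ex_RInt_continuous_everywhere.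
rewrite (RInt_substitution f (fun x => c - x) (fun _ => -1)); trivial.
- rewrite <- (RInt_opp (V := R_CompleteNormedModule)).
  + apply RInt_ext. intros x _. unfold opp; simpl. ring.
  + apply ex_RInt_continuous_everywhere. intros x.
    apply continuous_cmul, Cc.
- intros x. auto_derive; trivial.
- intros x. apply continuous_const.
Qed.

(** Here [s1] is the time at which the ray t - x = y leaves the curve l, and
    [s1 y + l (s1 y)] labels the incoming ray that is reflected there. Both
    labels are C^1 functions of that time, with derivatives comparable up to
    the factor k. *)
Lemma reflected_mass (l d s1 g : R -> R) (m b k u v : R) :
  timelike l d -> inverse_on (fun s => s - l s) m b s1 -> m <= b ->
  (forall s, m <= s <= b -> 1 - d s <= k * (1 + d s)) ->
  (forall y, continuous g y) -> (forall y, 0 <= g y) ->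
  m - l m <= u -> u <= v -> v <= b - l b ->
  RInt (fun y => g (s1 y + l (s1 y))) u v <= k * RInt g (m + l m) (b + l b).
Proof.
intros Tl Hs1 Hmb Hk Cg Pg Hu Huv Hv.
destruct (timelike_plus _ _ Tl) as (Cp & Dp & Cp' & Ip).
destruct (timelike_minus _ _ Tl) as (Cm & Dm & Cm' & Im).
assert (Cgp : forall s, continuous (fun s => g (s + l s)) s).
{ intros s. apply (continuous_comp (fun s => s + l s) g); [apply Cp|apply Cg]. }
assert (Cgd : forall s, continuous (fun s => (1 + d s) * g (s + l s)) s).
{ intros s. apply (continuous_mult (K := R_AbsRing) (fun s => 1 + d s)); [apply Cp'|apply Cgp]. }
rewrite (RInt_substitution g (fun s => s + l s) (fun s => 1 + d s)) by trivial.
rewrite <- RInt_cmul by trivial.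
apply (inverse_on_mass (fun s => s - l s) (fun s => 1 - d s) s1 (fun s => g (s + l s))); auto.
- intros y. apply continuous_cmul, Cgd.
- intros s Hs. rewrite <- Rmult_assoc. apply Rmult_le_compat_r; auto.
Qed.

(** Beyond the ray that leaves the left curve at time m, all rays are followed
    back in time, so the depth is t. A p-ray starts on the right curve or, if
    that would be before time e, on the boundary of the triangle, where
    [inner_estimate] applies; a q-ray starts on the left curve by reflection. *)
Lemma outer_estimate (l1 d1 l2 d2 : R -> R) (a m e b K k : R) :
  two_ray_geometry l1 d1 l2 d2 a m e b -> 0 <= K -> 1 <= k ->
  (forall s, m <= s <= b -> 1 - d1 s <= k * (1 + d1 s)) ->
  exists C, 0 < C /\
  forall (sp s1 : R -> R) (B : R) (p q phi : R -> R -> R) (h : R -> R),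
  inverse_on (fun s => s + l2 s) a b sp -> inverse_on (fun s => s - l1 s) m b s1 ->
  characteristic_system l1 l2 a b K k p q phi h ->
  0 < B -> RInt (fun t => Rabs (h t)) a b <= B ->
  forall t x, m <= t <= b -> l1 t <= x <= l2 t -> m - l1 m <= t - x ->
  Rabs (p t x) <= C * (Rabs (h (sp (t + x))) + B) /\
  Rabs (q t x) <= C * (Rabs (h (sp (s1 (t - x) + l1 (s1 (t - x))))) + B) /\
  Rabs (phi t x) <= C * B.
Proof.
intros G HK Hk1 Hk. pose proof (two_ray_order _ _ _ _ _ _ _ _ G) as Hord.
destruct (inner_estimate _ _ _ _ _ _ _ _ K G HK) as (Ci & HCi & Hin).
destruct G as (T1 & T2 & Hl & Ha & He & Heb).
destruct (timelike_plus _ _ T1) as (C1p & D1p & C1p' & I1p).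
destruct (timelike_minus _ _ T1) as (C1m & D1m & C1m' & I1m).
destruct (timelike_plus _ _ T2) as (C2p & D2p & C2p' & I2p).
destruct (timelike_minus _ _ T2) as (C2m & D2m & C2m' & I2m).
destruct (ray_propagation K k (b - a) HK Hk1) as (C & HC & HP); [lra|].
exists (C * (Ci + 2) * (2 * k)). split; [repeat apply Rmult_lt_0_compat; lra|].
intros sp s1 B p q phi h Hsp Hs1 HS HB HhB t0 x0 Ht0 Hx0 Heta0.
destruct (clamped_inverse_exists (fun s => s - l2 s) a e) as [sm Hsm]; trivial; [lra|].
change (inverse_on (fun s => s - l2 s) a e sm) in Hsm.
assert (Ch : forall y, continuous (fun y => Rabs (h y)) y).
{ intros y. apply continuous_Rabs_comp, HS. }
set (mp := fun y => Rabs (h (sp y))). set (mq := fun y => mp (s1 y + l1 (s1 y))).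
assert (Cmp : forall y, continuous mp y).
{ intros y. apply (continuous_comp sp (fun y => Rabs (h y))); [apply Hsp|apply Ch]. }
assert (Pmp : forall y, 0 <= mp y) by (intros; apply Rabs_pos).
assert (Cmq : forall y, continuous mq y).
{ intros y. apply (continuous_comp (fun y => s1 y + l1 (s1 y)) mp); [|apply Cmp].
  apply (continuous_comp s1 (fun s => s + l1 s)); [apply Hs1|apply C1p]. }
assert (Hmp : forall u v, a + l2 a <= u -> u <= v -> v <= b + l2 b -> RInt mp u v <= 2 * B).
{ intros u v Hu Huv Hv. apply Rle_trans with (RInt (fun y => 2 * Rabs (h y)) a b).
  - apply (inverse_on_mass (fun s => s + l2 s) (fun s => 1 + d2 s) sp
     (fun y => Rabs (h y)) (fun y => 2 * Rabs (h y)) a b u v); auto; try lra.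
    + intros y. apply Rabs_pos.
    + intros y. apply continuous_cmul, Ch.
    + intros s _. destruct T2 as (_ & _ & Hd). pose proof (Hd s). pose proof (Rabs_pos (h s)). nra.
  - rewrite RInt_cmul by trivial. lra. }
assert (Hb2 : b + l1 b < b + l2 b) by (pose proof (Hl b); lra).
assert (Hmq : forall u v, m - l1 m <= u -> u <= v -> v <= b - l1 b -> RInt mq u v <= 2 * k * B).
{ intros u v Hu Huv Hv.
  apply Rle_trans with (k * RInt mp (m + l1 m) (b + l1 b)).
  - apply (reflected_mass l1 d1 s1 mp); auto; lra.
  - replace (2 * k * B) with (k * (2 * B)) by ring. apply Rmult_le_compat_l; [lra|].
    apply Hmp; try lra. apply (increasing_le (fun s => s + l1 s)); trivial. lra. }
assert (H2B : 2 * B <= 2 * k * B) by nra.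
set (Om := fun t x => m <= t <= b /\ l1 t <= x <= l2 t /\ m - l1 m <= t - x).
assert (HOmxi : forall t x, Om t x -> a + l2 a <= t + x <= b + l2 b).
{ intros t x (Ht & Hx & _). pose proof (increasing_le _ _ _ I1p (proj1 Ht)).
  pose proof (increasing_le _ _ _ I2p (proj2 Ht)). simpl in *. lra. }
assert (HOmeta : forall t x, Om t x -> m - l1 m <= t - x <= b - l1 b).
{ intros t x (Ht & Hx & Heta). pose proof (increasing_le _ _ _ I1m (proj2 Ht)). simpl in *. lra. }
assert (Hgoal : Rabs (p t0 x0) <= C * (Ci + 2) * (mp (t0 + x0) + 2 * k * B) /\
   Rabs (q t0 x0) <= C * (Ci + 2) * (mq (t0 - x0) + 2 * k * B) /\
   Rabs (phi t0 x0) <= C * (Ci + 2) * (2 * k * B)).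
{ apply (HP 1 (- a) (Ci + 2) (2 * k * B) Om p q phi mp mq
     (fun y => RInt mp 0 y) (fun y => RInt mq 0 y)); try lra; auto.
  - intros y. apply Rabs_pos.
  - now apply RInt_primitive.
  - now apply RInt_primitive.
  - apply HS.
  - apply HS.
  - apply HS.
  - destruct (system_bounded l1 d1 l2 d2 a b p q phi) as [S HSb]; auto; try lra; try apply HS.
    exists S. intros t x (Ht & Hx & _). apply HSb; lra.
  - intros t x (Ht & Hx & _). unfold depth. lra.
  - intros t x Ho. pose proof (HOmxi t x Ho) as Hxi. pose proof (HOmeta t x Ho) as Heta'.
    destruct Ho as (Ht & Hx & Heta).
    set (s0 := sp (t + x)).
    assert (Hs0b : a <= s0 <= b) by apply Hsp.
    assert (Hs0 : s0 + l2 s0 = t + x) by (apply Hsp; lra).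
    assert (Hle : s0 <= t) by (apply (increasing_le_inv (fun s => s + l2 s)); simpl; trivial; lra).
    assert (Hpath : forall s, s0 < s < t -> l1 s < t + x - s < l2 s).
    { intros s Hs. pose proof (I2p s0 s (proj1 Hs)) as Hs2.
      pose proof (timelike_cone _ _ s t T1 (proj2 Hs)) as Hc. simpl in *. lra. }
    assert (Hmps : mp (t + x) = Rabs (h s0)) by reflexivity.
    pose proof (Rabs_pos (h s0)) as Hh0.
    assert (Hpathm : forall s, s0 < s < t -> m - l1 m <= 2 * s - (t + x) -> m <= s).
    { intros s Hs Hm. pose proof (Hpath s Hs).
      apply (increasing_le_inv (fun s => s - l1 s)); trivial. lra. }
    destruct (Rle_or_lt (m - l1 m) (s0 - l2 s0)) as [Hcase|Hcase].
    + exists s0. split; trivial. split; [|split].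
      * replace (t + x - s0) with (l2 s0) by lra. rewrite Hmps.
        pose proof (cs_p2 HS s0). 
        assert (2 * Rabs (h s0) <= (Ci + 2) * Rabs (h s0)) by (apply Rmult_le_compat_r; lra).
        assert (0 <= (Ci + 2) * (2 * k * B)) by (apply Rmult_le_pos; lra). lra.
      * rewrite RInt_primitive_diff by trivial. apply Hmq; lra.
      * intros s Hs. pose proof (Hpath s Hs). pose proof (Hpathm s Hs ltac:(lra)).
        split; [unfold Om; lra|].
        apply (cs_left HS (t + x) s); lra.
    + set (s0' := (t + x + (m - l1 m)) / 2).
      assert (Hs0' : s0 < s0' <= t) by (unfold s0'; lra).
      exists s0'. split; [lra|]. split; [|split].
      * assert (Hin' : l1 s0' <= t + x - s0' <= l2 s0').
        { pose proof (I2p s0 s0' (proj1 Hs0')) as Hs2. simpl in Hs2.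
          destruct (proj2 Hs0') as [Hlt|Heq].
          - pose proof (timelike_cone _ _ s0' t T1 Hlt). lra.
          - rewrite Heq. lra. }
        pose proof (Hin sp sm k B p q phi h Hsp Hsm HS HB HhB s0' (t + x - s0') ltac:(lra) Hin') as Hp.
        replace (s0' + (t + x - s0')) with (t + x) in Hp by ring.
        assert (Hp' : Rabs (p s0' (t + x - s0')) <= Ci * (Rabs (h s0) + B)).
        { apply Hp; [lra|]. unfold s0'. lra. }
        rewrite Hmps. eapply Rle_trans; [exact Hp'|]. apply Rmult_le_compat; lra.
      * replace (2 * s0' - (t + x)) with (m - l1 m) by (unfold s0'; field).
        rewrite RInt_primitive_diff by trivial. apply Hmq; lra.
      * intros s Hs. assert (Hs' : s0 < s < t) by lra.
        pose proof (Hpath s Hs').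
        assert (m - l1 m <= 2 * s - (t + x)) by (unfold s0' in Hs; lra).
        pose proof (Hpathm s Hs' ltac:(lra)).
        split; [unfold Om; lra|].
        apply (cs_left HS (t + x) s); lra.
  - intros t x Ho. pose proof (HOmxi t x Ho) as Hxi. pose proof (HOmeta t x Ho) as Heta'.
    destruct Ho as (Ht & Hx & Heta).
    set (r := s1 (t - x)).
    assert (Hrb : m <= r <= b) by apply Hs1.
    assert (Hr : r - l1 r = t - x) by (apply Hs1; lra).
    assert (Hle : r <= t) by (apply (increasing_le_inv (fun s => s - l1 s)); simpl; trivial; lra).
    pose proof (Hl r) as Hlr.
    exists r. split; [lra|].
    replace (r - (t - x)) with (l1 r) by lra. split; [right|split; [|split]].
    + split; [unfold Om; lra|]. split.
      * apply (cs_q1 HS r). lra.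
      * replace (2 * r - (t - x)) with (r + l1 r) by lra. apply Rle_refl.
    + apply HS.
    + rewrite RInt_primitive_diff by trivial. rewrite Rmult_1_l.
      apply Rle_trans with (2 * B); [|lra]. apply Hmp; try lra.
      pose proof (increasing_le _ m r I1p). simpl in *; lra.
    + intros s Hs Hs'.
      assert (Hlt1 : r < s) by lra. assert (Hlt2 : s < t) by lra.
      pose proof (I1m r s Hlt1) as Hs2.
      pose proof (timelike_cone _ _ s t T2 Hlt2) as Hc. simpl in *.
      split; [unfold Om; lra|].
      apply (cs_right HS (t - x) s); lra.
  - unfold Om. lra. }
destruct Hgoal as (G1 & G2 & G3).
assert (Hfin : forall y, 0 <= y -> C * (Ci + 2) * (y + 2 * k * B) <= C * (Ci + 2) * (2 * k) * (y + B)).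
{ intros y Hy. rewrite (Rmult_assoc (C * (Ci + 2))).
  apply Rmult_le_compat_l; [apply Rmult_le_pos; lra|]. nra. }
split; [|split].
- eapply Rle_trans; [exact G1|]. apply Hfin, Pmp.
- eapply Rle_trans; [exact G2|]. apply Hfin, Pmp.
- lra.
Qed.

(** * Observability for characteristic systems *)

(** The Cauchy-Schwarz inequality, as the integral of the pointwise inequality
    |h| <= w h^2 + 1 / (4 w) with w = (b - a) / (2 B). *)
Lemma RInt_abs_le_of_sq (h : R -> R) (a b B : R) :
  (forall t, continuous h t) -> a < b -> 0 < B -> (b - a) * RInt (fun t => (h t) ^ 2) a b <= B ^ 2 ->
  RInt (fun t => Rabs (h t)) a b <= B.
Proof.
intros Ch Hab HB HH.
assert (Ch2 : forall t, continuous (fun t => (h t) ^ 2) t).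
{ intros t. apply continuous_sq, Ch. }
set (w := (b - a) / (2 * B)).
set (v := B / (2 * (b - a))).
assert (Hw : 0 < w) by (apply Rdiv_lt_0_compat; lra).
assert (E : RInt (fun t => w * (h t) ^ 2 + v) a b = w * RInt (fun t => (h t) ^ 2) a b + (b - a) * v).
{ rewrite (RInt_plus (V := R_CompleteNormedModule) (fun t => w * (h t) ^ 2) (fun _ => v)).
  - rewrite RInt_cmul by trivial.
    pose proof (RInt_const (V := R_CompleteNormedModule) a b v) as E'.
    change (RInt (fun _ => v) a b = (b - a) * v) in E'. now rewrite E'.
  - apply ex_RInt_continuous_everywhere. intros t. apply continuous_cmul, Ch2.
  - apply ex_RInt_continuous_everywhere. intros t. apply continuous_const. }
apply Rle_trans with (RInt (fun t => w * (h t) ^ 2 + v) a b).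
- apply RInt_le; [lra| | |].
  + apply ex_RInt_continuous_everywhere. intros t. apply continuous_Rabs_comp, Ch.
  + apply ex_RInt_continuous_everywhere. intros t. apply (continuous_plus (V := R_NormedModule)); [|apply continuous_const].
    apply continuous_cmul, Ch2.
  + intros t _. rewrite <- (pow2_abs (h t)).
    assert (Hwv : w * v = / 4) by (unfold w, v; field; lra).
    set (y := Rabs (h t)).
    assert (0 <= (2 * w * y - 1) ^ 2) by apply pow2_ge_0.
    apply (Rmult_le_reg_l (4 * w)); [lra|].
    replace (4 * w * (w * y ^ 2 + v)) with (4 * w * w * y ^ 2 + 4 * (w * v)) by ring.
    rewrite Hwv. nra.
- rewrite E.
  assert (w * RInt (fun t => (h t) ^ 2) a b <= B / 2).
  { apply (Rmult_le_reg_l (2 * B)); [lra|].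
    replace (2 * B * (w * RInt (fun t => (h t) ^ 2) a b))
      with ((b - a) * RInt (fun t => (h t) ^ 2) a b) by (unfold w; field; lra).
    replace (2 * B * (B / 2)) with (B ^ 2) by field. exact HH. }
  assert ((b - a) * v = B / 2) by (unfold v; field; lra). lra.
Qed.

(** At time b >= e the whole slice lies where [outer_estimate] holds. Its squared
    bounds are integrated by changing variables to the time at which rays meet the
    right curve, and B is chosen with B^2 as close as desired to
    (b - a) times the integral of h^2. *)
Lemma final_slice_observability (l1 d1 l2 d2 : R -> R) (a m e b K k : R) :
  two_ray_geometry l1 d1 l2 d2 a m e b -> 0 <= K -> 1 <= k ->
  (forall s, m <= s <= b -> 1 - d1 s <= k * (1 + d1 s)) ->
  exists C, 0 < C /\
  forall (p q phi : R -> R -> R) (h : R -> R),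
  characteristic_system l1 l2 a b K k p q phi h ->
  RInt (fun x => (p b x) ^ 2 + (q b x) ^ 2 + (phi b x) ^ 2) (l1 b) (l2 b)
    <= C * RInt (fun t => (h t) ^ 2) a b.
Proof.
intros G HK Hk1 Hk. pose proof (two_ray_order _ _ _ _ _ _ _ _ G) as Hord.
destruct (outer_estimate _ _ _ _ _ _ _ _ K k G HK Hk1 Hk) as (C & HC & Hout).
destruct G as (T1 & T2 & Hl & Ha & He & Heb).
destruct (timelike_plus _ _ T1) as (C1p & D1p & C1p' & I1p).
destruct (timelike_minus _ _ T1) as (C1m & D1m & C1m' & I1m).
destruct (timelike_plus _ _ T2) as (C2p & D2p & C2p' & I2p).
destruct (timelike_minus _ _ T2) as (C2m & D2m & C2m' & I2m).
destruct (clamped_inverse_exists (fun s => s + l2 s) a b) as [sp Hsp]; trivial; [lra|].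
change (inverse_on (fun s => s + l2 s) a b sp) in Hsp.
destruct (clamped_inverse_exists (fun s => s - l1 s) m b) as [s1 Hs1]; trivial; [lra|].
change (inverse_on (fun s => s - l1 s) m b s1) in Hs1.
pose proof (Hl b) as Hlb.
set (width := l2 b - l1 b).
set (C' := C ^ 2 * (4 + 4 * k + 5 * width)).
assert (HC2 : 0 < C ^ 2) by (apply pow_lt; lra).
assert (HC' : 0 < C') by (apply Rmult_lt_0_compat; unfold width; lra).
exists (C' * (1 + (b - a))). split; [apply Rmult_lt_0_compat; lra|].
intros p q phi h HS.
set (H := RInt (fun t => (h t) ^ 2) a b).
assert (Ch2 : forall t, continuous (fun t => (h t) ^ 2) t).
{ intros t. apply continuous_sq, HS. }
assert (HH : 0 <= H).
{ apply RInt_ge_0; [lra|now apply ex_RInt_continuous_everywhere|]. intros; apply pow2_ge_0. }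
set (mp2 := fun y => (h (sp y)) ^ 2). set (mq2 := fun y => mp2 (s1 y + l1 (s1 y))).
assert (Cmp2 : forall y, continuous mp2 y).
{ intros y. apply (continuous_comp sp (fun y => (h y) ^ 2)); [apply Hsp|apply Ch2]. }
assert (Cmq2 : forall y, continuous mq2 y).
{ intros y. apply (continuous_comp (fun y => s1 y + l1 (s1 y)) mp2); [|apply Cmp2].
  apply (continuous_comp s1 (fun s => s + l1 s)); [apply Hs1|apply C1p]. }
assert (Hmp2 : forall u v, a + l2 a <= u -> u <= v -> v <= b + l2 b -> RInt mp2 u v <= 2 * H).
{ intros u v Hu Huv Hv. 
  unfold H. rewrite <- RInt_cmul by trivial.
  apply (inverse_on_mass (fun s => s + l2 s) (fun s => 1 + d2 s) sp
     (fun y => (h y) ^ 2) (fun y => 2 * (h y) ^ 2) a b u v); auto; try lra.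
  - intros y. apply pow2_ge_0.
  - intros y. apply continuous_cmul, Ch2.
  - intros s _. destruct T2 as (_ & _ & Hd). pose proof (Hd s). pose proof (pow2_ge_0 (h s)). nra. }
assert (Hp : RInt (fun x => mp2 (b + x)) (l1 b) (l2 b) <= 2 * H).
{ pose proof (RInt_substitution mp2 (fun x => b + x) (fun _ => 1) (l1 b) (l2 b)) as E.
  rewrite (RInt_ext (V := R_CompleteNormedModule) (fun x => mp2 (b + x)) (fun x => 1 * mp2 (b + x)))
    by (intros; symmetry; apply Rmult_1_l).
  rewrite <- E; trivial.
  - apply Hmp2; try lra. pose proof (increasing_le _ m b I1p). simpl in *; lra.
  - intros x. auto_derive; trivial.
  - intros x. apply continuous_const. }
assert (Hq : RInt (fun x => mq2 (b - x)) (l1 b) (l2 b) <= 2 * k * H).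
{ rewrite (RInt_reflect mq2) by trivial.
  apply Rle_trans with (k * RInt mp2 (m + l1 m) (b + l1 b)).
  - apply (reflected_mass l1 d1 s1 mp2); auto; try lra.
    + intros y. apply pow2_ge_0.
    + pose proof (increasing_le _ e b I2m). simpl in *; lra.
  - replace (2 * k * H) with (k * (2 * H)) by ring. apply Rmult_le_compat_l; [lra|].
    apply Hmp2; try lra. apply (increasing_le (fun s => s + l1 s)); trivial. lra. }
assert (Hmain : forall B, 0 < B -> (b - a) * H <= B ^ 2 ->
  RInt (fun x => (p b x) ^ 2 + (q b x) ^ 2 + (phi b x) ^ 2) (l1 b) (l2 b) <= C' * (H + B ^ 2)).
{ intros B HB HBH.
  assert (HhB : RInt (fun t => Rabs (h t)) a b <= B).
  { apply RInt_abs_le_of_sq; trivial; [apply HS|lra]. }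
  assert (Cf : forall f, jointly_continuous f -> forall x, continuous (fun x => (f b x) ^ 2) x).
  { intros f Cf x. apply continuous_sq.
    apply (jointly_continuous_comp f (fun _ => b) (fun x => x)); trivial; [apply continuous_const|apply continuous_id]. }
  assert (Cp1 : forall x, continuous (fun x => mp2 (b + x)) x).
  { intros x. apply (continuous_comp (fun x => b + x) mp2); [|apply Cmp2].
    apply (ex_derive_continuous (V := R_NormedModule)). auto_derive; trivial. }
  assert (Cq1 : forall x, continuous (fun x => mq2 (b - x)) x).
  { intros x. apply (continuous_comp (fun x => b - x) mq2); [|apply Cmq2].
    apply (ex_derive_continuous (V := R_NormedModule)). auto_derive; trivial. }
  set (c2 := 2 * C ^ 2).
  set (c5 := 5 * C ^ 2 * B ^ 2).
  set (maj := fun x => (c2 * mp2 (b + x) + c2 * mq2 (b - x)) + c5).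
  assert (C1 : forall x, continuous (fun x => c2 * mp2 (b + x)) x).
  { intros x. apply continuous_cmul, Cp1. }
  assert (C2 : forall x, continuous (fun x => c2 * mq2 (b - x)) x).
  { intros x. apply continuous_cmul, Cq1. }
  assert (C12 : forall x, continuous (fun x => c2 * mp2 (b + x) + c2 * mq2 (b - x)) x).
  { intros x. apply (continuous_plus (V := R_NormedModule)); auto. }
  apply Rle_trans with (RInt maj (l1 b) (l2 b)).
  - apply RInt_le; [lra| | |].
    + apply ex_RInt_continuous_everywhere. intros x.
      apply (continuous_plus (V := R_NormedModule) (fun x => (p b x) ^ 2 + (q b x) ^ 2)).
      * apply (continuous_plus (V := R_NormedModule) (fun x => (p b x) ^ 2)); apply Cf; apply HS.
      * apply Cf, HS.
    + apply ex_RInt_continuous_everywhere. intros x.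
      apply (continuous_plus (V := R_NormedModule) (fun x => c2 * mp2 (b + x) + c2 * mq2 (b - x)));
        [apply C12|apply continuous_const].
    + intros x Hx.
      destruct (Hout sp s1 B p q phi h Hsp Hs1 HS HB HhB b x) as (G1 & G2 & G3); try lra.
      { pose proof (increasing_le _ e b I2m). simpl in *; lra. }
      assert (Hsq : forall f g, Rabs f <= C * (Rabs g + B) -> f ^ 2 <= 2 * C ^ 2 * g ^ 2 + 2 * C ^ 2 * B ^ 2).
      { intros f g Hfg. rewrite <- (pow2_abs f), <- (pow2_abs g).
        apply Rle_trans with ((C * (Rabs g + B)) ^ 2).
        - apply pow_incr. split; [apply Rabs_pos|exact Hfg].
        - assert (0 <= C ^ 2 * (Rabs g - B) ^ 2) by (apply Rmult_le_pos; [lra|apply pow2_ge_0]). nra. }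
      apply Hsq in G1. apply Hsq in G2.
      assert (G3' : (phi b x) ^ 2 <= C ^ 2 * B ^ 2).
      { rewrite <- (pow2_abs (phi b x)). replace (C ^ 2 * B ^ 2) with ((C * B) ^ 2) by ring.
        apply pow_incr. split; [apply Rabs_pos|exact G3]. }
      unfold maj, c2, c5, mq2, mp2. lra.
  - assert (E : RInt maj (l1 b) (l2 b) =
       c2 * RInt (fun x => mp2 (b + x)) (l1 b) (l2 b) + c2 * RInt (fun x => mq2 (b - x)) (l1 b) (l2 b)
       + width * c5).
    { unfold maj.
      rewrite (RInt_plus (V := R_CompleteNormedModule) (fun x => c2 * mp2 (b + x) + c2 * mq2 (b - x)) (fun _ => c5))
        by (apply ex_RInt_continuous_everywhere; trivial; intros; apply continuous_const).
      rewrite (RInt_plus (V := R_CompleteNormedModule) (fun x => c2 * mp2 (b + x)) (fun x => c2 * mq2 (b - x)))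
        by (apply ex_RInt_continuous_everywhere; trivial).
      rewrite (RInt_const (V := R_CompleteNormedModule)).
      rewrite !RInt_cmul by trivial. reflexivity. }
    rewrite E.
    assert (c2 * RInt (fun x => mp2 (b + x)) (l1 b) (l2 b) <= c2 * (2 * H)) by (apply Rmult_le_compat_l; unfold c2; lra).
    assert (c2 * RInt (fun x => mq2 (b - x)) (l1 b) (l2 b) <= c2 * (2 * k * H)) by (apply Rmult_le_compat_l; unfold c2; lra).
    assert (0 < B ^ 2) by (apply pow_lt; lra).
    assert (0 <= C ^ 2 * ((4 + 4 * k) * B ^ 2)) by (apply Rmult_le_pos; nra).
    assert (0 <= C ^ 2 * (width * H)).
    { apply Rmult_le_pos; [lra|]. apply Rmult_le_pos; unfold width; lra. }
    unfold c2, c5, C' in *. lra. }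
(* [B] must be positive even when [H] vanishes, hence the margin [eps] *)
apply le_epsilon. intros eps Heps.
assert (Hpos : 0 < (b - a) * H + eps / C').
{ assert (0 < eps / C') by (apply Rdiv_lt_0_compat; lra). nra. }
pose proof (Hmain (sqrt ((b - a) * H + eps / C')) (sqrt_lt_R0 _ Hpos)) as Hf.
rewrite pow2_sqrt in Hf by lra.
assert (0 < eps / C') by (apply Rdiv_lt_0_compat; lra).
specialize (Hf ltac:(lra)).
replace (C' * (H + ((b - a) * H + eps / C'))) with (C' * (1 + (b - a)) * H + eps) in Hf by (field; lra).
exact Hf.
Qed.

Lemma characteristic_system_restrict (l1 l2 : R -> R) (a b a' b' K k : R)
    (p q phi : R -> R -> R) (h : R -> R) :
  a <= a' -> b' <= b ->
  characteristic_system l1 l2 a b K k p q phi h ->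
  characteristic_system l1 l2 a' b' K k p q phi h.
Proof.
intros Ha Hb [Cp Cq Cphi Ch Left Right Phi1 Phi2 Q1 P1 P2 Q2]. constructor; trivial; intros.
- apply Left; lra.
- apply Right; lra.
- apply Q1; lra.
- apply P1; lra.
Qed.

Lemma derivative_bounded_reverse (F G : R -> R) (s b : R) :
  (forall s, G s = F (- s)) -> derivative_bounded F (- s) b -> derivative_bounded G s b.
Proof.
intros E (r & Hr & Hle). exists (- r). split; [|now rewrite Rabs_Ropp].
apply (is_derive_ext (fun s => F (- s))); [intros; symmetry; apply E|].
replace (- r) with (-1 * r) by ring.
apply (is_derive_comp (V := R_NormedModule) F Ropp s r (-1) Hr).
auto_derive; trivial. 
Qed.

Lemma characteristic_system_reverse (l1 l2 : R -> R) (a b K k : R)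
    (p q phi : R -> R -> R) (h : R -> R) :
  characteristic_system l1 l2 a b K k p q phi h ->
  characteristic_system (fun t => l1 (- t)) (fun t => l2 (- t)) (- b) (- a) K k
    (fun t x => q (- t) x) (fun t x => p (- t) x) (fun t x => phi (- t) x) (fun t => h (- t)).
Proof.
intros [Cp Cq Cphi Ch Left Right Phi1 Phi2 Q1 P1 P2 Q2].
assert (Copp : forall f, jointly_continuous f -> jointly_continuous (fun t x => f (- t) x)).
{ intros f Cf z. apply (continuous_comp_2 (fun z => - fst z) snd f).
  - apply (continuous_opp (V := R_NormedModule) (fun z : R * R => fst z)). apply continuous_fst.
  - apply continuous_snd.
  - apply Cf. }
constructor; auto.
- intros t. apply (continuous_comp Ropp h); [|apply Ch].
  apply (continuous_opp (V := R_NormedModule) (fun t => t)). apply continuous_id.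
- intros y s Hs Hx.
  replace (y - s) with (- s - - y) in Hx |- * by ring.
  destruct (Right (- y) (- s)) as [H1 H2]; try lra.
  split.
  + apply (derivative_bounded_reverse (fun s => q s (s - - y))).
    * intros u. f_equal. ring.
    * unfold amplitude in *. now rewrite (Rplus_comm (Rabs (q _ _))).
  + apply (derivative_bounded_reverse (fun s => phi s (s - - y))); trivial.
    intros u. f_equal. ring.
- intros y s Hs Hx.
  replace (s - y) with (- y - - s) in Hx |- * by ring.
  destruct (Left (- y) (- s)) as [H1 H2]; try lra.
  split.
  + apply (derivative_bounded_reverse (fun s => p s (- y - s))).
    * intros u. f_equal. ring.
    * unfold amplitude in *. now rewrite (Rplus_comm (Rabs (q _ _))).
  + apply (derivative_bounded_reverse (fun s => phi s (- y - s))); trivial.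
    intros u. f_equal. ring.
- intros t Ht. apply P1. lra.
- intros t Ht. apply Q1. lra.
Qed.

Lemma timelike_reverse (l d : R -> R) :
  timelike l d -> timelike (fun t => l (- t)) (fun t => - d (- t)).
Proof.
intros (Hl & Cd & Hd). split; [|split].
- intros t. replace (- d (- t)) with (-1 * d (- t)) by ring.
  apply (is_derive_comp (V := R_NormedModule) l Ropp t _ (-1) (Hl (- t))).
  auto_derive; trivial.
- intros t. apply (continuous_opp (V := R_NormedModule) (fun t => d (- t))).
  apply (continuous_comp Ropp d); [|apply Cd].
  apply (continuous_opp (V := R_NormedModule) (fun t => t)). apply continuous_id.
- intros t. pose proof (Hd (- t)). lra.
Qed.

(** Reversed in time, the zigzag starts at -e and ends at -a, and the initial slice
    becomes the final one of the time interval [-e, -a]. *)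
Lemma initial_slice_observability (l1 d1 l2 d2 : R -> R) (a m e b K k : R) :
  two_ray_geometry l1 d1 l2 d2 a m e b -> 0 <= K -> 1 <= k ->
  (forall s, a <= s <= b -> 1 + d1 s <= k * (1 - d1 s)) ->
  exists C, 0 < C /\
  forall (p q phi : R -> R -> R) (h : R -> R),
  characteristic_system l1 l2 a b K k p q phi h ->
  RInt (fun x => (p a x) ^ 2 + (q a x) ^ 2 + (phi a x) ^ 2) (l1 a) (l2 a)
    <= C * RInt (fun t => (h t) ^ 2) a b.
Proof.
intros G HK Hk1 Hk. pose proof (two_ray_order _ _ _ _ _ _ _ _ G) as Hord.
destruct G as (T1 & T2 & Hl & Ha & He & Heb).
destruct (final_slice_observability (fun t => l1 (- t)) (fun t => - d1 (- t))
   (fun t => l2 (- t)) (fun t => - d2 (- t)) (- e) (- m) (- a) (- a) K k) as (C & HC & HP); trivial.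
- split; [now apply timelike_reverse|]. split; [now apply timelike_reverse|].
  rewrite !Ropp_involutive. repeat split; auto; lra.
- intros s Hs. assert (Hs' : a <= - s <= b) by lra. apply Hk in Hs'. lra.
- exists C. split; trivial. intros p q phi h HS.
  assert (HS' := characteristic_system_reverse _ _ _ _ _ _ _ _ _ _
    (characteristic_system_restrict l1 l2 a b a e K k p q phi h (Rle_refl a) Heb HS)).
  apply HP in HS'. rewrite Ropp_involutive in HS'.
  rewrite (RInt_ext (V := R_CompleteNormedModule) _
     (fun x => (p a x) ^ 2 + (q a x) ^ 2 + (phi a x) ^ 2)) in HS'.
  2:{ intros x _. change ((q a x) ^ 2 + (p a x) ^ 2 + (phi a x) ^ 2
        = (p a x) ^ 2 + (q a x) ^ 2 + (phi a x) ^ 2). ring. }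
  eapply Rle_trans; [exact HS'|]. apply Rmult_le_compat_l; [lra|].
  assert (Ch2 : forall t, continuous (fun t => (h t) ^ 2) t).
  { intros t. apply continuous_sq, HS. }
  rewrite (RInt_ext (V := R_CompleteNormedModule) (fun t => (h (- t)) ^ 2) (fun t => (h (0 - t)) ^ 2)).
  2:{ intros x _. now rewrite Rminus_0_l. }
  rewrite (RInt_reflect (fun t => (h t) ^ 2)) by trivial.
  replace (0 - - a) with a by ring. replace (0 - - e) with e by ring.
  apply RInt_nonneg_mono; auto; try lra. intros x. apply pow2_ge_0.
Qed.

(** * From the wave equation to a characteristic system *)
Lemma closure_region (l1 l2 : R -> R) (t x : R) :
  l1 t < l2 t -> l1 t <= x <= l2 t -> closure (region l1 l2) (t, x).
Proof.
intros Hl Hx eps.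
set (w := l2 t - l1 t).
assert (Hw : 0 < w) by (unfold w; lra).
pose proof (cond_pos eps) as He.
set (th := eps / (eps + w)).
assert (Hth0 : 0 < th) by (apply Rdiv_lt_0_compat; lra).
assert (Eth : th * (eps + w) = eps) by (unfold th; field; lra).
assert (Hth1 : th < 1) by nra.
exists (t, x + th * ((l1 t + l2 t) / 2 - x)). split.
- split; [apply ball_center|].
  change (Rabs (x + th * ((l1 t + l2 t) / 2 - x) - x) < eps).
  replace (x + th * ((l1 t + l2 t) / 2 - x) - x) with (th * ((l1 t + l2 t) / 2 - x)) by ring.
  unfold w in *. apply Rabs_def1; nra.
- unfold region; simpl. nra.
Qed.

Definition clamp (l1 l2 : R -> R) (t x : R) : R := Rmax (l1 t) (Rmin x (l2 t)).

(** The values of f outside the closed region are replaced by its values on the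
    boundary, which makes a function continuous on the closure continuous on the
    plane. *)
Definition clamped (l1 l2 : R -> R) (f : R -> R -> R) (t x : R) : R := f t (clamp l1 l2 t x).

Lemma clamp_bounds (l1 l2 : R -> R) (t x : R) :
  l1 t < l2 t -> l1 t <= clamp l1 l2 t x <= l2 t.
Proof.
intros H. unfold clamp. split; [apply Rmax_l|]. apply Rmax_lub; [lra|apply Rmin_r].
Qed.

Lemma clamped_eq (l1 l2 : R -> R) (f : R -> R -> R) (t x : R) :
  l1 t <= x <= l2 t -> clamped l1 l2 f t x = f t x.
Proof. intros H. unfold clamped, clamp. rewrite Rmin_left, Rmax_right; lra. Qed.

Lemma continuous_Rmax {U : UniformSpace} (f g : U -> R) (z : U) :
  continuous f z -> continuous g z -> continuous (fun z => Rmax (f z) (g z)) z.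
Proof.
intros Cf Cg.
apply (continuous_ext (fun z => / 2 * ((f z + g z) + Rabs (f z - g z)))).
- intros y. unfold Rmax, Rabs. destruct (Rle_dec _ _), (Rcase_abs _); lra.
- apply continuous_cmul.
  apply (continuous_plus (V := R_NormedModule) (fun z => f z + g z)).
  + apply (continuous_plus (V := R_NormedModule)); trivial.
  + apply (continuous_comp (fun z => f z - g z) Rabs); [|apply continuous_Rabs].
    apply (continuous_minus (V := R_NormedModule)); trivial.
Qed.

Lemma continuous_Rmin {U : UniformSpace} (f g : U -> R) (z : U) :
  continuous f z -> continuous g z -> continuous (fun z => Rmin (f z) (g z)) z.
Proof.
intros Cf Cg. apply (continuous_ext (fun z => - Rmax (- f z) (- g z))).
- intros y. unfold Rmin, Rmax. destruct (Rle_dec _ _), (Rle_dec _ _); lra.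
- apply (continuous_opp (V := R_NormedModule) (fun z => Rmax (- f z) (- g z))).
  apply continuous_Rmax; now apply (continuous_opp (V := R_NormedModule)).
Qed.

Lemma jointly_continuous_clamped (l1 l2 : R -> R) (f : R -> R -> R) :
  (forall t, continuous l1 t) -> (forall t, continuous l2 t) -> (forall t, l1 t < l2 t) ->
  continuous_on_closure (region l1 l2) f -> jointly_continuous (clamped l1 l2 f).
Proof.
intros C1 C2 Hl Hf z.
set (rho := fun z : R * R => (fst z, clamp l1 l2 (fst z) (snd z))).
assert (Cl : forall z, closure (region l1 l2) (rho z)).
{ intros y. apply closure_region; auto. apply clamp_bounds, Hl. }
assert (Crho : filterlim rho (locally z) (locally (rho z))).
{ apply filterlim_locally. intros eps.
  assert (H1 : continuous (fun z : R * R => fst z) z) by apply continuous_fst.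
  assert (H2 : continuous (fun z : R * R => clamp l1 l2 (fst z) (snd z)) z).
  { unfold clamp. apply continuous_Rmax.
    - apply (continuous_comp fst l1); [apply continuous_fst|apply C1].
    - apply continuous_Rmin; [apply continuous_snd|].
      apply (continuous_comp fst l2); [apply continuous_fst|apply C2]. }
  pose proof (proj1 (filterlim_locally _ _) H1 eps) as H1'.
  pose proof (proj1 (filterlim_locally _ _) H2 eps) as H2'.
  generalize (filter_and _ _ H1' H2'). apply filter_imp. intros y [Y1 Y2]. split; trivial. }
specialize (Hf (rho z) (Cl z)).
intros P HP. specialize (Hf P HP). unfold filtermap, within in Hf. apply Crho in Hf.
unfold filtermap in *. revert Hf. apply filter_imp. intros y Hy. apply Hy, Cl.
Qed.

Lemma region_open (l1 d1 l2 d2 : R -> R) (t x : R) :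
  timelike l1 d1 -> timelike l2 d2 -> region l1 l2 (t, x) ->
  locally_2d (fun u v => region l1 l2 (u, v)) t x.
Proof.
unfold region; simpl. intros T1 T2 Hx.
assert (Hdel : 0 < Rmin (x - l1 t) (l2 t - x) / 2).
{ apply Rdiv_lt_0_compat; [apply Rmin_pos|]; lra. }
exists (mkposreal _ Hdel). simpl. intros u v Hu Hv.
pose proof (Rmin_l (x - l1 t) (l2 t - x)). pose proof (Rmin_r (x - l1 t) (l2 t - x)).
apply Rabs_def2 in Hu. apply Rabs_def2 in Hv.
destruct (Rtotal_order u t) as [H1|[->|H1]].
- pose proof (timelike_cone _ _ u t T1 H1). pose proof (timelike_cone _ _ u t T2 H1). lra.
- lra.
- pose proof (timelike_cone _ _ t u T1 H1). pose proof (timelike_cone _ _ t u T2 H1). lra.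
Qed.

Lemma C1_differentiable (U : R * R -> Prop) (f : R -> R -> R) (t x : R) :
  Ck 1 U f -> locally_2d (fun u v => U (u, v)) t x ->
  differentiable_pt_lim f t x (dt f t x) (dx f t x).
Proof.
intros Hf Hloc.
assert (Hx : U (t, x)) by (apply (locally_2d_singleton _ _ _ Hloc)).
apply filterdiff_differentiable_pt_lim.
assert (H := is_derive_filterdiff f t x (dt f) (dx f t x)).
eapply filterdiff_ext_lin.
- apply H.
  + apply locally_2d_locally in Hloc. revert Hloc. apply filter_imp. intros [u v] Huv. simpl in *.
    destruct (Hf u v Huv) as (_ & H1 & _). apply Derive_correct, H1.
  + destruct (Hf t x Hx) as (_ & _ & H2 & _). apply Derive_correct, H2.
  + destruct (Hf t x Hx) as (_ & _ & _ & (H3 & _) & _).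
    apply (continuity_2d_pt_filterlim (dt f)). exact H3.
- intros [u v]. reflexivity.
Qed.

Lemma is_derive_along (f : R -> R -> R) (c : R -> R) (t x A B c' : R) :
  differentiable_pt_lim f t x A B -> is_derive c t c' -> c t = x ->
  is_derive (fun s => f s (c s)) t (A + B * c').
Proof.
intros Hf Hc <-. apply is_derive_Reals.
replace (A + B * c') with (A * 1 + B * c') by ring.
apply (derivable_pt_lim_comp_2d f (fun s => s) c); trivial.
- apply derivable_pt_lim_id.
- now apply is_derive_Reals.
Qed.

Lemma clamped_differentiable (l1 d1 l2 d2 : R -> R) (f : R -> R -> R) (t x A B : R) :
  timelike l1 d1 -> timelike l2 d2 -> region l1 l2 (t, x) ->
  differentiable_pt_lim f t x A B -> differentiable_pt_lim (clamped l1 l2 f) t x A B.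
Proof.
intros T1 T2 Hx. apply differentiable_pt_lim_ext.
destruct (region_open _ _ _ _ t x T1 T2 Hx) as [del Hdel].
exists del. intros u v Hu Hv. symmetry. apply clamped_eq.
specialize (Hdel u v Hu Hv). unfold region in Hdel; simpl in Hdel. lra.
Qed.

(** The values on the boundary are those of a limit, so phi itself cannot be
    differentiated there. Instead, use the curves that divide the width of the
    region in the ratio th : 1 - th. For 0 < th < 1 they run inside the region,
    and a nonzero tangential derivative at the boundary would force phi to grow
    at a fixed rate along all of them with th near th0, against phi = 0 in the
    limit. *)
Lemma boundary_tangential (l1 d1 l2 d2 : R -> R) (phi gt gx : R -> R -> R) (th0 : R) :
  timelike l1 d1 -> timelike l2 d2 -> (forall t, l1 t < l2 t) ->
  jointly_continuous phi -> jointly_continuous gt -> jointly_continuous gx ->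
  (forall t x, region l1 l2 (t, x) -> differentiable_pt_lim phi t x (gt t x) (gx t x)) ->
  0 <= th0 <= 1 ->
  (forall t, phi t (l1 t + th0 * (l2 t - l1 t)) = 0) ->
  forall t, gt t (l1 t + th0 * (l2 t - l1 t))
    + gx t (l1 t + th0 * (l2 t - l1 t)) * (d1 t + th0 * (d2 t - d1 t)) = 0.
Proof.
intros T1 T2 Hl Cphi Cgt Cgx Hdiff Hth0 Hzero t0.
set (c := fun t th => l1 t + th * (l2 t - l1 t)).
set (c' := fun t th => d1 t + th * (d2 t - d1 t)).
set (H := fun t th => gt t (c t th) + gx t (c t th) * c' t th).
change (H t0 th0 = 0).
assert (Clin : forall u v, (forall t, continuous u t) -> (forall t, continuous v t) ->
   jointly_continuous (fun t th => u t + th * (v t - u t))).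
{ intros u v Cu Cv z.
  assert (Cu' : continuous (fun z : R * R => u (fst z)) z).
  { apply (continuous_comp fst u); [apply continuous_fst|apply Cu]. }
  assert (Cv' : continuous (fun z : R * R => v (fst z)) z).
  { apply (continuous_comp fst v); [apply continuous_fst|apply Cv]. }
  apply (continuous_plus (V := R_NormedModule) (fun z : R * R => u (fst z))); trivial.
  apply (continuous_mult (K := R_AbsRing) (fun z : R * R => snd z)); [apply continuous_snd|].
  apply (continuous_minus (V := R_NormedModule)); trivial. }
assert (Cc : jointly_continuous c).
{ apply Clin; intros t; [apply (timelike_continuous l1 d1 t T1)|apply (timelike_continuous l2 d2 t T2)]. }
assert (Cc' : jointly_continuous c') by (apply Clin; [apply T1|apply T2]).
assert (Ccomp : forall f, jointly_continuous f -> jointly_continuous (fun t th => f t (c t th))).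
{ intros f Cf z. apply (continuous_comp_2 fst (fun z => c (fst z) (snd z)) f).
  - apply continuous_fst.
  - apply Cc.
  - apply Cf. }
assert (CH : jointly_continuous H).
{ intros z. apply (continuous_plus (V := R_NormedModule) (fun z : R * R => gt (fst z) (c (fst z) (snd z)))).
  - apply (Ccomp gt Cgt).
  - apply (continuous_mult (K := R_AbsRing) (fun z : R * R => gx (fst z) (c (fst z) (snd z)))).
    + apply (Ccomp gx Cgx).
    + apply Cc'. }
destruct (Req_dec (H t0 th0) 0) as [E|Hne]; trivial. exfalso.
set (A := Rabs (H t0 th0)).
assert (HA : 0 < A) by now apply Rabs_pos_lt.
assert (HCH : continuity_2d_pt H t0 th0) by (apply continuity_2d_pt_filterlim; apply CH).
destruct (HCH (mkposreal (A / 2) ltac:(lra))) as [del Hdel]. simpl in Hdel.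
pose proof (cond_pos del) as Hdp.
set (t1 := t0 + del / 2).
assert (CF : jointly_continuous (fun t th => phi t (c t th))) by now apply Ccomp.
assert (Hsmall : forall t, exists e : posreal, forall th, Rabs (th - th0) < e ->
   Rabs (phi t (c t th)) < A / 2 * (del / 2) / 2).
{ intros t.
  assert (Hc : continuity_2d_pt (fun t th => phi t (c t th)) t th0)
    by (apply continuity_2d_pt_filterlim; apply CF).
  destruct (Hc (mkposreal (A / 2 * (del / 2) / 2) ltac:(nra))) as [e He]. simpl in He.
  exists e. intros th Hth.
  assert (Hz : phi t (c t th0) = 0) by apply Hzero.
  specialize (He t th). rewrite Hz, Rminus_0_r in He. apply He; trivial.
  rewrite Rminus_diag, Rabs_R0. apply cond_pos. }
destruct (Hsmall t0) as [e0 He0]. destruct (Hsmall t1) as [e1 He1].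
assert (Hth : exists th, 0 < th < 1 /\ Rabs (th - th0) < del /\ Rabs (th - th0) < e0 /\ Rabs (th - th0) < e1).
{ set (mu := Rmin 1 (Rmin del (Rmin e0 e1)) / 2).
  assert (Hmu : 0 < mu /\ mu <= / 2 /\ mu < del /\ mu < e0 /\ mu < e1).
  { pose proof (cond_pos e0). pose proof (cond_pos e1).
    assert (0 < Rmin 1 (Rmin del (Rmin e0 e1))) by (repeat apply Rmin_pos; lra).
    pose proof (Rmin_l 1 (Rmin del (Rmin e0 e1))). pose proof (Rmin_r 1 (Rmin del (Rmin e0 e1))).
    pose proof (Rmin_l del (Rmin e0 e1)). pose proof (Rmin_r del (Rmin e0 e1)).
    pose proof (Rmin_l e0 e1). pose proof (Rmin_r e0 e1). unfold mu. lra. }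
  exists (th0 + mu * (/ 2 - th0)).
  assert (Hab : Rabs (th0 + mu * (/ 2 - th0) - th0) < mu).
  { replace (th0 + mu * (/ 2 - th0) - th0) with (mu * (/ 2 - th0)) by ring. apply Rabs_def1; nra. }
  split; [nra|]. lra. }
destruct Hth as (th & Hth & Hth1 & Hth2 & Hth3).
assert (HcU : forall t, region l1 l2 (t, c t th)).
{ intros t. unfold region, c; simpl. pose proof (Hl t). nra. }
destruct (MVT_cor2 (fun t => phi t (c t th)) (fun t => H t th) t0 t1) as [s [Es Hs]].
- unfold t1; lra.
- intros s _. apply is_derive_Reals.
  apply (is_derive_along phi (fun t => c t th) s (c s th) (gt s (c s th)) (gx s (c s th)) (c' s th)); trivial.
  + apply Hdiff, HcU.
  + apply (is_derive_plus (V := R_NormedModule) l1 (fun t => th * (l2 t - l1 t))); [apply T1|].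
    apply (is_derive_scal (fun t => l2 t - l1 t)).
    apply (is_derive_minus (V := R_NormedModule)); [apply T2|apply T1].
- specialize (He0 th Hth2). specialize (He1 th Hth3).
  assert (HHs : Rabs (H s th - H t0 th0) < A / 2).
  { apply Hdel; trivial. unfold t1 in Hs. apply Rabs_def1; lra. }
  assert (HHs2 : A / 2 < Rabs (H s th)).
  { assert (Hab : A <= Rabs (H s th) + Rabs (H s th - H t0 th0)); [|lra].
    unfold A. rewrite (Rabs_minus_sym (H s th)).
    replace (H t0 th0) with (H s th + (H t0 th0 - H s th)) at 1 by ring. apply Rabs_triang. }
  assert (Hab : Rabs (phi t1 (c t1 th) - phi t0 (c t0 th)) = Rabs (H s th) * (del / 2)).
  { rewrite Es, Rabs_mult. f_equal. unfold t1. rewrite Rabs_pos_eq; lra. }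
  assert (Hab2 : Rabs (phi t1 (c t1 th) - phi t0 (c t0 th)) <= Rabs (phi t1 (c t1 th)) + Rabs (phi t0 (c t0 th))).
  { unfold Rminus. rewrite <- (Rabs_Ropp (phi t0 _)). apply Rabs_triang. }
  nra.
Qed.

(** The mixed derivatives of phi_t and phi_x agree by the theorem of Schwarz, so
    that they cancel when phi_t + phi_x is differentiated along t + x = const, or
    phi_t - phi_x along t - x = const; up to sign the wave operator remains. *)
Lemma null_derivatives (U : R * R -> Prop) (phi : R -> R -> R) (t x : R) :
  Ck 2 U phi -> locally_2d (fun u v => U (u, v)) t x ->
  differentiable_pt_lim phi t x (dt phi t x) (dx phi t x) /\
  exists ptt ptx pxx,
    differentiable_pt_lim (dt phi) t x ptt ptx /\
    differentiable_pt_lim (dx phi) t x ptx pxx /\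
    box phi t x = - ptt + pxx.
Proof.
intros Hphi Hloc.
assert (H1 : Ck 1 U phi).
{ intros u v Huv. apply (ex_diff_n_m 2 1); [auto|]. now apply Hphi. }
assert (H2 : Ck 1 U (dt phi)).
{ intros u v Huv. destruct (Hphi u v Huv) as (_ & _ & _ & H & _). exact H. }
assert (H3 : Ck 1 U (dx phi)).
{ intros u v Huv. destruct (Hphi u v Huv) as (_ & _ & _ & _ & H). exact H. }
split; [now apply (C1_differentiable U)|].
assert (HU : U (t, x)) by (apply (locally_2d_singleton _ _ _ Hloc)).
assert (Hsch : dt (dx phi) t x = dx (dt phi) t x).
{ apply (Schwarz phi t x).
  - revert Hloc. apply locally_2d_impl, locally_2d_forall. intros u v Huv.
    destruct (H1 u v Huv) as (_ & A1 & A2 & _).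
    destruct (H2 u v Huv) as (_ & _ & A3 & _). destruct (H3 u v Huv) as (_ & A4 & _).
    split; [exact A1|]. split; [exact A2|]. split; [exact A4|exact A3].
  - destruct (H3 t x HU) as (_ & _ & _ & (A & _) & _). exact A.
  - destruct (H2 t x HU) as (_ & _ & _ & _ & (A & _)). exact A. }
exists (dt (dt phi) t x), (dx (dt phi) t x), (dx (dx phi) t x).
split; [now apply (C1_differentiable U)|]. split; [|reflexivity].
rewrite <- Hsch. now apply (C1_differentiable U).
Qed.

Lemma differentiable_pt_lim_plus (f g : R -> R -> R) (t x A B A' B' : R) :
  differentiable_pt_lim f t x A B -> differentiable_pt_lim g t x A' B' ->
  differentiable_pt_lim (fun t x => f t x + g t x) t x (A + A') (B + B').
Proof.
intros Hf Hg. apply filterdiff_differentiable_pt_lim.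
apply filterdiff_differentiable_pt_lim in Hf. apply filterdiff_differentiable_pt_lim in Hg.
eapply filterdiff_ext_lin; [apply (filterdiff_plus_fct _ _ _ _ Hf Hg)|].
intros [u v]. simpl. unfold plus; simpl. ring.
Qed.

Lemma differentiable_pt_lim_minus (f g : R -> R -> R) (t x A B A' B' : R) :
  differentiable_pt_lim f t x A B -> differentiable_pt_lim g t x A' B' ->
  differentiable_pt_lim (fun t x => f t x - g t x) t x (A - A') (B - B').
Proof.
intros Hf Hg. apply filterdiff_differentiable_pt_lim.
apply filterdiff_differentiable_pt_lim in Hf. apply filterdiff_differentiable_pt_lim in Hg.
eapply filterdiff_ext_lin; [apply (filterdiff_minus_fct _ _ _ _ Hf Hg)|].
intros [u v]. simpl. unfold minus, plus, opp; simpl. ring.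
Qed.

Lemma continuous_on_closure_linear (U : R * R -> Prop) (f g : R -> R -> R) (c : R) :
  continuous_on_closure U f -> continuous_on_closure U g ->
  continuous_on_closure U (fun t x => f t x + c * g t x).
Proof.
intros Hf Hg z Hz. specialize (Hf z Hz). specialize (Hg z Hz).
apply (filterlim_comp_2 (F := within (closure U) (locally z))
   (fun z : R * R => f (fst z) (snd z)) (fun z : R * R => c * g (fst z) (snd z)) Rplus
   (G := locally (f (fst z) (snd z))) (H := locally (c * g (fst z) (snd z)))); trivial.
- apply (filterlim_comp _ _ _ _ (Rmult c) _ _ _ Hg). apply (filterlim_scal_r (V := R_NormedModule) c).
- apply (filterlim_plus (V := R_NormedModule)).
Qed.

Lemma timelike_of_smooth (l : R -> R) :
  smooth l -> (forall t, Rabs (Derive l t) < 1) -> timelike l (Derive l).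
Proof.
intros Hs Hl. split; [|split].
- intros t. apply Derive_correct. apply (Hs 1%nat t).
- intros t. apply (ex_derive_continuous (V := R_NormedModule)). apply (Hs 2%nat t).
- intros t. apply Rabs_lt_between, Hl.
Qed.

Lemma timelike_strict (l d : R -> R) (a b : R) :
  timelike l d -> a <= b -> exists mu, 0 <= mu < 1 /\ forall t, a <= t <= b -> Rabs (d t) <= mu.
Proof.
intros (_ & Cd & Hd) Hab.
destruct (continuity_ab_maj (fun t => Rabs (d t)) a b Hab) as (M & HM & _).
- intros c _. apply continuity_pt_filterlim. apply (continuous_Rabs_comp d), Cd.
- exists (Rabs (d M)). split; trivial. split; [apply Rabs_pos|].
  apply Rabs_lt_between, Hd.
Qed.

Lemma coefficient_bounded (l1 d1 l2 d2 : R -> R) (f : R -> R -> R) (a b : R) :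
  timelike l1 d1 -> timelike l2 d2 -> (forall t, l1 t < l2 t) -> a <= b ->
  Cinfty_closure (region l1 l2) f ->
  exists M, 0 <= M /\ forall t x, a <= t <= b -> l1 t <= x <= l2 t -> Rabs (f t x) <= M.
Proof.
intros T1 T2 Hl Hab Hf. destruct (Hf 0%nat) as (_ & Hc & _).
destruct (jointly_continuous_bounded (clamped l1 l2 f) a b (l1 a - (b - a)) (l2 a + (b - a))) as [M HM]; trivial.
- apply jointly_continuous_clamped; trivial; intros t;
    [apply (timelike_continuous l1 d1 t T1)|apply (timelike_continuous l2 d2 t T2)].
- pose proof (Hl a). lra.
- exists (Rmax 0 M). split; [apply Rmax_l|]. intros t x Ht Hx.
  rewrite <- (clamped_eq l1 l2 f t x Hx). eapply Rle_trans; [|apply Rmax_r].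
  apply HM; trivial. now apply (slab_bound l1 d1 l2 d2 a b t x).
Qed.

(** Along its null rays p, or q, changes at the rate - box phi, which the equation
    expresses by terms of lower order. On the boundary phi_t = - l' phi_x, so that
    p = (1 - l') phi_x and q = - (1 + l') phi_x there. *)
Lemma characteristic_system_of_solution (l1 d1 l2 d2 : R -> R) (X : R -> R -> R * R)
    (V : R -> R -> R) (a b K k : R) (phi gt gx : R -> R -> R) :
  timelike l1 d1 -> timelike l2 d2 -> (forall t, l1 t < l2 t) ->
  (forall t x, a <= t <= b -> l1 t <= x <= l2 t ->
     Rabs (fst (X t x)) <= K /\ Rabs (snd (X t x)) <= K /\ Rabs (V t x) <= K) ->
  (forall t, a <= t <= b -> 1 + d1 t <= k * (1 - d1 t) /\ 1 - d1 t <= k * (1 + d1 t)) ->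
  Ck 2 (region l1 l2) phi -> continuous_on_closure (region l1 l2) phi ->
  continuous_extension (region l1 l2) (dt phi) gt ->
  continuous_extension (region l1 l2) (dx phi) gx ->
  (forall t x, region l1 l2 (t, x) ->
     box phi t x + nabla X phi t x + V t x * phi t x = 0) ->
  (forall t, phi t (l1 t) = 0) -> (forall t, phi t (l2 t) = 0) ->
  characteristic_system l1 l2 a b K k
    (clamped l1 l2 (fun t x => gt t x + 1 * gx t x)) (clamped l1 l2 (fun t x => gt t x + -1 * gx t x))
    (clamped l1 l2 phi) (fun t => gx t (l2 t)).
Proof.
intros T1 T2 Hl HK Hk Hphi Cphi [Egt Cgt] [Egx Cgx] Heq Hphi1 Hphi2.
assert (C1 : forall t, continuous l1 t) by (intros t; apply (timelike_continuous l1 d1 t T1)).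
assert (C2 : forall t, continuous l2 t) by (intros t; apply (timelike_continuous l2 d2 t T2)).
pose proof (jointly_continuous_clamped l1 l2 phi C1 C2 Hl Cphi) as Hcphi.
pose proof (jointly_continuous_clamped l1 l2 gt C1 C2 Hl Cgt) as Hcgt.
pose proof (jointly_continuous_clamped l1 l2 gx C1 C2 Hl Cgx) as Hcgx.
set (p := clamped l1 l2 (fun t x => gt t x + 1 * gx t x)).
set (q := clamped l1 l2 (fun t x => gt t x + -1 * gx t x)).
set (u := clamped l1 l2 phi).
assert (E2 : forall (f : R -> R -> R) t, clamped l1 l2 f t (l2 t) = f t (l2 t)).
{ intros f t. apply clamped_eq. pose proof (Hl t). lra. }
assert (E1 : forall (f : R -> R -> R) t, clamped l1 l2 f t (l1 t) = f t (l1 t)).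
{ intros f t. apply clamped_eq. pose proof (Hl t). lra. }
assert (Eint : forall (f : R -> R -> R) t x, region l1 l2 (t, x) -> clamped l1 l2 f t x = f t x).
{ intros f t x Hx. apply clamped_eq. unfold region in Hx; simpl in Hx. lra. }
assert (Hint : forall t x, region l1 l2 (t, x) ->
   p t x = dt phi t x + dx phi t x /\ q t x = dt phi t x - dx phi t x /\ u t x = phi t x /\
   differentiable_pt_lim u t x (dt phi t x) (dx phi t x) /\
   exists ptt ptx pxx,
     differentiable_pt_lim p t x (ptt + ptx) (ptx + pxx) /\
     differentiable_pt_lim q t x (ptt - ptx) (ptx - pxx) /\
     box phi t x = - ptt + pxx).
{ intros t x Hx.
  pose proof (region_open l1 d1 l2 d2 t x T1 T2 Hx) as Hloc.
  destruct (null_derivatives _ phi t x Hphi Hloc) as (D0 & ptt & ptx & pxx & D1 & D2 & Eb).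
  split; [unfold p; rewrite (Eint _ t x Hx), Egt, Egx by trivial; ring|].
  split; [unfold q; rewrite (Eint _ t x Hx), Egt, Egx by trivial; ring|].
  split; [now apply Eint|].
  split; [now apply (clamped_differentiable l1 d1 l2 d2)|].
  exists ptt, ptx, pxx. split; [|split; trivial].
  - apply (differentiable_pt_lim_ext (fun t x => dt phi t x + dx phi t x)).
    + revert Hloc. apply locally_2d_impl, locally_2d_forall. intros v w Hvw.
      unfold p. rewrite (Eint _ v w Hvw), Egt, Egx by trivial. ring.
    + now apply differentiable_pt_lim_plus.
  - apply (differentiable_pt_lim_ext (fun t x => dt phi t x - dx phi t x)).
    + revert Hloc. apply locally_2d_impl, locally_2d_forall. intros v w Hvw.
      unfold q. rewrite (Eint _ v w Hvw), Egt, Egx by trivial. ring.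
    + now apply differentiable_pt_lim_minus. }
assert (Hrate : forall t x, a < t < b -> region l1 l2 (t, x) ->
   Rabs (box phi t x) <= K * amplitude p q u t x).
{ intros t x Ht Hx. destruct (Hint t x Hx) as (Ep & Eq & Eu & _).
  unfold region in Hx; simpl in Hx.
  destruct (HK t x) as (K1 & K2 & K3); [lra|lra|].
  assert (E : box phi t x = - (fst (X t x) * dt phi t x + snd (X t x) * dx phi t x + V t x * phi t x)).
  { specialize (Heq t x Hx). unfold nabla in Heq. lra. }
  rewrite E, Rabs_Ropp. unfold amplitude.
  assert (Hdt : dt phi t x = (p t x + q t x) / 2) by lra.
  assert (Hdx : dx phi t x = (p t x - q t x) / 2) by lra.
  assert (H1 : Rabs (dt phi t x) + Rabs (dx phi t x) <= Rabs (p t x) + Rabs (q t x)).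
  { rewrite Hdt, Hdx. unfold Rabs; repeat destruct (Rcase_abs _); lra. }
  eapply Rle_trans; [apply Rabs_triang|].
  eapply Rle_trans; [apply Rplus_le_compat_r, Rabs_triang|].
  rewrite !Rabs_mult, Eu.
  pose proof (Rabs_pos (dt phi t x)). pose proof (Rabs_pos (dx phi t x)). pose proof (Rabs_pos (phi t x)).
  assert (Rabs (fst (X t x)) * Rabs (dt phi t x) <= K * Rabs (dt phi t x)) by (apply Rmult_le_compat_r; lra).
  assert (Rabs (snd (X t x)) * Rabs (dx phi t x) <= K * Rabs (dx phi t x)) by (apply Rmult_le_compat_r; lra).
  assert (Rabs (V t x) * Rabs (phi t x) <= K * Rabs (phi t x)) by (apply Rmult_le_compat_r; lra).
  assert (0 <= K) by (pose proof (Rabs_pos (V t x)); lra).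
  assert (K * (Rabs (dt phi t x) + Rabs (dx phi t x)) <= K * (Rabs (p t x) + Rabs (q t x)))
    by (apply Rmult_le_compat_l; lra).
  lra. }
assert (Htan : forall th, 0 <= th <= 1 -> (forall t, u t (l1 t + th * (l2 t - l1 t)) = 0) ->
  forall t, clamped l1 l2 gt t (l1 t + th * (l2 t - l1 t))
    + clamped l1 l2 gx t (l1 t + th * (l2 t - l1 t)) * (d1 t + th * (d2 t - d1 t)) = 0).
{ intros th Hth Hz. apply (boundary_tangential l1 d1 l2 d2 u); trivial.
  intros t x Hx. rewrite !Eint, Egt, Egx by trivial. apply (Hint t x Hx). }
assert (Htan2 : forall t, gt t (l2 t) = - d2 t * gx t (l2 t)).
{ intros t. pose proof (Htan 1 ltac:(lra)) as H.
  assert (Hz : forall t, u t (l1 t + 1 * (l2 t - l1 t)) = 0).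
  { intros s. replace (l1 s + 1 * (l2 s - l1 s)) with (l2 s) by ring. unfold u. now rewrite E2. }
  specialize (H Hz t). replace (l1 t + 1 * (l2 t - l1 t)) with (l2 t) in H by ring.
  rewrite !E2 in H. lra. }
assert (Htan1 : forall t, gt t (l1 t) = - d1 t * gx t (l1 t)).
{ intros t. pose proof (Htan 0 ltac:(lra)) as H.
  assert (Hz : forall t, u t (l1 t + 0 * (l2 t - l1 t)) = 0).
  { intros s. replace (l1 s + 0 * (l2 s - l1 s)) with (l1 s) by ring. unfold u. now rewrite E1. }
  specialize (H Hz t). replace (l1 t + 0 * (l2 t - l1 t)) with (l1 t) in H by ring.
  rewrite !E1 in H. lra. }
constructor.
- apply jointly_continuous_clamped; trivial. now apply continuous_on_closure_linear.
- apply jointly_continuous_clamped; trivial. now apply continuous_on_closure_linear.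
- exact Hcphi.
- intros t. apply (continuous_ext (fun t => clamped l1 l2 gx t (l2 t))); [intros; apply E2|].
  apply (jointly_continuous_comp (clamped l1 l2 gx) (fun t => t) l2); trivial. apply continuous_id.
- intros y s Hs Hx. destruct (Hint s (y - s) Hx) as (Ep & Eq & Eu & D0 & ptt & ptx & pxx & D1 & _ & Eb).
  assert (Dc : is_derive (fun s => y - s) s (-1)) by (auto_derive; trivial; ring).
  split.
  + exists ((ptt + ptx) + (ptx + pxx) * -1). split.
    * apply (is_derive_along p (fun s => y - s) s (y - s)); trivial.
    * replace (ptt + ptx + (ptx + pxx) * -1) with (- box phi s (y - s)) by (rewrite Eb; ring).
      rewrite Rabs_Ropp. now apply Hrate.
  + exists (dt phi s (y - s) + dx phi s (y - s) * -1). split.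
    * apply (is_derive_along u (fun s => y - s) s (y - s)); trivial.
    * rewrite Eq. right. f_equal. ring.
- intros y s Hs Hx. destruct (Hint s (s - y) Hx) as (Ep & Eq & Eu & D0 & ptt & ptx & pxx & _ & D1 & Eb).
  assert (Dc : is_derive (fun s => s - y) s 1) by (auto_derive; trivial; ring).
  split.
  + exists ((ptt - ptx) + (ptx - pxx) * 1). split.
    * apply (is_derive_along q (fun s => s - y) s (s - y)); trivial.
    * replace (ptt - ptx + (ptx - pxx) * 1) with (- box phi s (s - y)) by (rewrite Eb; ring).
      rewrite Rabs_Ropp. now apply Hrate.
  + exists (dt phi s (s - y) + dx phi s (s - y) * 1). split.
    * apply (is_derive_along u (fun s => s - y) s (s - y)); trivial.
    * rewrite Ep. right. f_equal. ring.
- intros t. unfold u. now rewrite E1.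
- intros t. unfold u. now rewrite E2.
- intros t Ht. unfold p, q. rewrite !E1, Htan1.
  replace (- d1 t * gx t (l1 t) + -1 * gx t (l1 t)) with (- ((1 + d1 t) * gx t (l1 t))) by ring.
  replace (- d1 t * gx t (l1 t) + 1 * gx t (l1 t)) with ((1 - d1 t) * gx t (l1 t)) by ring.
  rewrite Rabs_Ropp, !Rabs_mult, <- Rmult_assoc. apply Rmult_le_compat_r; [apply Rabs_pos|].
  destruct T1 as (_ & _ & Hd). pose proof (Hd t). rewrite !Rabs_pos_eq by lra. now apply Hk.
- intros t Ht. unfold p, q. rewrite !E1, Htan1.
  replace (- d1 t * gx t (l1 t) + -1 * gx t (l1 t)) with (- ((1 + d1 t) * gx t (l1 t))) by ring.
  replace (- d1 t * gx t (l1 t) + 1 * gx t (l1 t)) with ((1 - d1 t) * gx t (l1 t)) by ring.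
  rewrite Rabs_Ropp, !Rabs_mult, <- Rmult_assoc. apply Rmult_le_compat_r; [apply Rabs_pos|].
  destruct T1 as (_ & _ & Hd). pose proof (Hd t). rewrite !Rabs_pos_eq by lra. now apply Hk.
- intros t. unfold p. rewrite E2, Htan2.
  replace (- d2 t * gx t (l2 t) + 1 * gx t (l2 t)) with ((1 - d2 t) * gx t (l2 t)) by ring.
  rewrite Rabs_mult. apply Rmult_le_compat_r; [apply Rabs_pos|].
  destruct T2 as (_ & _ & Hd). pose proof (Hd t). rewrite !Rabs_pos_eq by lra. lra.
- intros t. unfold q. rewrite E2, Htan2.
  replace (- d2 t * gx t (l2 t) + -1 * gx t (l2 t)) with (- ((1 + d2 t) * gx t (l2 t))) by ring.
  rewrite Rabs_Ropp, Rabs_mult. apply Rmult_le_compat_r; [apply Rabs_pos|].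
  destruct T2 as (_ & _ & Hd). pose proof (Hd t). rewrite !Rabs_pos_eq by lra. lra.
Qed.

(** * Energies *)
Lemma slice_energy_le (l1 l2 : R -> R) (s : R) (phi gt gx : R -> R -> R) :
  l1 s < l2 s -> 
  (forall t x, region l1 l2 (t, x) -> gt t x = dt phi t x) ->
  (forall t x, region l1 l2 (t, x) -> gx t x = dx phi t x) ->
  let p := clamped l1 l2 (fun t x => gt t x + 1 * gx t x) in
  let q := clamped l1 l2 (fun t x => gt t x + -1 * gx t x) in
  let u := clamped l1 l2 phi in
  jointly_continuous p -> jointly_continuous q -> jointly_continuous u ->
  slice_integral l1 l2 s (fun t x => grad_sq phi t x + (phi t x) ^ 2)
    <= RInt (fun x => (p s x) ^ 2 + (q s x) ^ 2 + (u s x) ^ 2) (l1 s) (l2 s).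
Proof.
intros Hl Egt Egx p q u Cp Cq Cu. unfold slice_integral.
assert (Csq : forall f, jointly_continuous f -> forall x, continuous (fun x => (f s x) ^ 2) x).
{ intros f Cf x. apply continuous_sq.
  apply (jointly_continuous_comp f (fun _ => s) (fun x => x)); trivial; [apply continuous_const|apply continuous_id]. }
assert (Cpq : forall x, continuous (fun x => (p s x) ^ 2 + (q s x) ^ 2) x).
{ intros x. apply (continuous_plus (V := R_NormedModule) (fun x => (p s x) ^ 2)); now apply Csq. }
rewrite (RInt_ext (V := R_CompleteNormedModule) _
  (fun x => / 2 * ((p s x) ^ 2 + (q s x) ^ 2) + (u s x) ^ 2)).
- apply RInt_le; [lra| | |].
  + apply ex_RInt_continuous_everywhere. intros x.
    apply (continuous_plus (V := R_NormedModule) (fun x => / 2 * ((p s x) ^ 2 + (q s x) ^ 2))).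
    * apply continuous_cmul, Cpq.
    * now apply Csq.
  + apply ex_RInt_continuous_everywhere. intros x.
    apply (continuous_plus (V := R_NormedModule) (fun x => (p s x) ^ 2 + (q s x) ^ 2)); [apply Cpq|now apply Csq].
  + intros x _. pose proof (pow2_ge_0 (p s x)). pose proof (pow2_ge_0 (q s x)). lra.
- rewrite Rmin_left, Rmax_right by lra. intros x Hx.
  assert (Hr : region l1 l2 (s, x)) by exact Hx.
  unfold p, q, u. rewrite !clamped_eq by lra. rewrite Egt, Egx by trivial. unfold grad_sq. 
  change ((dt phi s x) ^ 2 + (dx phi s x) ^ 2 + (phi s x) ^ 2 =
   / 2 * ((dt phi s x + 1 * dx phi s x) ^ 2 + (dt phi s x + -1 * dx phi s x) ^ 2) + (phi s x) ^ 2).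
  field.
Qed.

Lemma curve_integral_ge (l : R -> R) (a b mu : R) (f : R -> R -> R) :
  timelike l (Derive l) -> a <= b -> 0 <= mu < 1 ->
  (forall t, a <= t <= b -> Rabs (Derive l t) <= mu) ->
  (forall t, continuous (fun t => f t (l t)) t) ->
  sqrt (1 - mu ^ 2) * RInt (fun t => (f t (l t)) ^ 2) a b
    <= curve_integral l a b (fun t x => (Rabs (f t x)) ^ 2).
Proof.
intros (Hl & Cd & Hd) Hab Hmu Hle Cf.
assert (Csq : forall t, continuous (fun t => (f t (l t)) ^ 2) t).
{ intros t. apply continuous_sq, Cf. }
rewrite <- RInt_cmul by trivial.
unfold curve_integral. apply RInt_le; trivial.
- apply ex_RInt_continuous_everywhere. intros t.
  apply continuous_cmul, Csq.
- apply ex_RInt_continuous_everywhere. intros t.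
  apply (continuous_mult (K := R_AbsRing) (fun t => (Rabs (f t (l t))) ^ 2)).
  + apply (continuous_ext (fun t => (f t (l t)) ^ 2)); [|apply Csq].
    intros s. symmetry. apply pow2_abs.
  + apply (continuous_ext (fun t => sqrt (1 - (Derive l t) ^ 2))).
    { intros s. now rewrite pow2_abs. }
    apply (continuous_comp (fun t => 1 - (Derive l t) ^ 2) sqrt); [|apply continuous_sqrt].
    apply (continuous_comp (Derive l) (fun y => 1 - y ^ 2)); [apply Cd|].
    apply (ex_derive_continuous (V := R_NormedModule)). auto_derive; trivial.
- intros t Ht. rewrite pow2_abs, Rmult_comm. apply Rmult_le_compat_l; [apply pow2_ge_0|].
  apply sqrt_le_1_alt. pose proof (Rabs_pos (Derive l t)).
  assert (Rabs (Derive l t) <= mu) by (apply Hle; lra).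
  assert (Rabs (Derive l t) ^ 2 <= mu ^ 2) by (apply pow_incr; lra). lra.
Qed.

Theorem theorem5p3 :
  forall (l1 l2 : R -> R) (X : R -> R -> R * R) (V : R -> R -> R) (taum taup : R),
  smooth l1 -> smooth l2 ->
  (forall tau, l1 tau < l2 tau) ->
  (forall tau, Rabs (Derive l1 tau) < 1) ->
  (forall tau, Rabs (Derive l2 tau) < 1) ->
  Cinfty_closure (region l1 l2) (fun t x => fst (X t x)) ->
  Cinfty_closure (region l1 l2) (fun t x => snd (X t x)) ->
  Cinfty_closure (region l1 l2) V ->
  forall Tm : R, 0 < Tm -> l2 taum - Tm = l1 (taum + Tm) ->
  forall Tp : R, 0 < Tp -> l1 (taum + Tm) + Tp = l2 (taum + Tm + Tp) ->
  taup > taum + Tm + Tp ->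
  exists C : R, 0 < C /\
    forall phi : R -> R -> R,
    Ck 2 (region l1 l2) phi ->
    Ck_closure 1 (region l1 l2) phi ->
    (forall t x, region l1 l2 (t, x) ->
       box phi t x + nabla X phi t x + V t x * phi t x = 0) ->
    (forall t, phi t (l1 t) = 0) ->
    (forall t, phi t (l2 t) = 0) ->
    (* [phix] is the continuous extension of d_x phi up to the boundary *)
    forall phix : R -> R -> R,
    continuous_extension (region l1 l2) (dx phi) phix ->
    slice_integral l1 l2 taum (fun t x => grad_sq phi t x + (phi t x)^2)
      <= C * curve_integral l2 taum taup (fun t x => (Rabs (phix t x))^2)
    /\
    slice_integral l1 l2 taup (fun t x => grad_sq phi t x + (phi t x)^2)
      <= C * curve_integral l2 taum taup (fun t x => (Rabs (phix t x))^2).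
Proof.
intros l1 l2 X V taum taup S1 S2 Hl D1 D2 HXt HXx HV Tm HTm Hm Tp HTp Hp Htaup.
pose proof (timelike_of_smooth l1 S1 D1) as T1.
pose proof (timelike_of_smooth l2 S2 D2) as T2.
assert (Hab : taum <= taup) by lra.
destruct (coefficient_bounded _ _ _ _ _ taum taup T1 T2 Hl Hab HXt) as (K1 & PK1 & HK1).
destruct (coefficient_bounded _ _ _ _ _ taum taup T1 T2 Hl Hab HXx) as (K2 & PK2 & HK2).
destruct (coefficient_bounded _ _ _ _ _ taum taup T1 T2 Hl Hab HV) as (K3 & PK3 & HK3).
set (K := K1 + K2 + K3).
destruct (timelike_strict _ _ taum taup T1 Hab) as (mu1 & Hmu1 & Hd1).
destruct (timelike_strict _ _ taum taup T2 Hab) as (mu2 & Hmu2 & Hd2).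
set (k := 2 / (1 - mu1)).
assert (Ek : k * (1 - mu1) = 2) by (unfold k; field; lra).
assert (Hk1 : 1 <= k) by nra.
assert (Hk : forall t, taum <= t <= taup ->
   1 + Derive l1 t <= k * (1 - Derive l1 t) /\ 1 - Derive l1 t <= k * (1 + Derive l1 t)).
{ intros t Ht. pose proof (Hd1 t Ht) as H. apply Rabs_le_between in H. split; nra. }
assert (G : two_ray_geometry l1 (Derive l1) l2 (Derive l2) taum (taum + Tm) (taum + Tm + Tp) taup).
{ split; [exact T1|]. split; [exact T2|]. split; [exact Hl|]. lra. }
destruct (final_slice_observability _ _ _ _ _ _ _ _ K k G) as (Cp & HCp & HPp); trivial.
{ unfold K; lra. }
{ intros s Hs. apply Hk. lra. }
destruct (initial_slice_observability _ _ _ _ _ _ _ _ K k G) as (Cm & HCm & HPm); trivial.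
{ unfold K; lra. }
{ intros s Hs. apply Hk. lra. }
set (c := sqrt (1 - mu2 ^ 2)).
assert (Hc : 0 < c) by (apply sqrt_lt_R0; nra).
exists ((Cp + Cm) / c). split; [apply Rdiv_lt_0_compat; lra|].
intros phi Hphi (_ & Cphi & Hext) Heq Hz1 Hz2 phix Hphix.
destruct (Hext 1%nat 0%nat (le_n 1)) as [gt Hgt].
assert (HS := characteristic_system_of_solution l1 (Derive l1) l2 (Derive l2) X V taum taup K k
  phi gt phix T1 T2 Hl).
specialize (HS ltac:(intros t x Ht Hx; pose proof (HK1 t x Ht Hx); pose proof (HK2 t x Ht Hx);
   pose proof (HK3 t x Ht Hx); unfold K; lra) Hk Hphi Cphi Hgt Hphix Heq Hz1 Hz2).
pose proof (HPp _ _ _ _ HS) as Fp. pose proof (HPm _ _ _ _ HS) as Fm.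
set (H := RInt (fun t => (phix t (l2 t)) ^ 2) taum taup) in *.
assert (Hcurve : c * H <= curve_integral l2 taum taup (fun t x => (Rabs (phix t x)) ^ 2)).
{ apply curve_integral_ge; trivial. apply HS. }
set (J := curve_integral l2 taum taup (fun t x => (Rabs (phix t x)) ^ 2)) in *.
assert (HH : 0 <= H).
{ apply RInt_ge_0; trivial.
  - apply ex_RInt_continuous_everywhere. intros t. apply continuous_sq, (cs_h HS).
  - intros t _. apply pow2_ge_0. }
assert (Hfin : (Cp + Cm) * H <= (Cp + Cm) / c * J).
{ replace ((Cp + Cm) * H) with ((Cp + Cm) / c * (c * H)) by (field; lra).
  apply Rmult_le_compat_l; trivial. apply Rlt_le, Rdiv_lt_0_compat; lra. }
assert (Hen : forall s, slice_integral l1 l2 s (fun t x => grad_sq phi t x + (phi t x) ^ 2)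
   <= _) by (intros s; apply (slice_energy_le l1 l2 s phi gt phix (Hl s) (proj1 Hgt) (proj1 Hphix));
   apply HS).
split; (eapply Rle_trans; [apply Hen|]); (eapply Rle_trans; [eassumption|]); nra.
Qed.
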